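(* Let $E$ be a locally compact Polish space. Let $T=(T(t))_{t>0}$ be a $\mathcal{C}_b$-semigroup of kernel operators on $\mathcal{B}_b(E)$ of type $(M,\omega)$ consisting of strong Feller operators, with full generator $\hat A$ and Laplace transform $(R(\lambda))_{\operatorname{Re}\lambda>\omega}$, and assume that $T$ is moreover a positive $\mathcal{C}_\infty$-semigroup. Let $\hat B:D(\hat B)\to\mathcal{B}_b(E)$ be a single-valued linear operator with $D(\hat A)\subset D(\hat B)$ such that: (i) for every $t>0$ the operator $\hat BT(t)$, defined on $D(\hat A)$, extends to a kernel operator on $\mathcal{B}_b(E)$ (again denoted $\hat BT(t)$); (ii) $\hat BR(\lambda)$ is a kernel operator for all $\lambda>\omega$; (iii) $(t,x)\mapsto\hat BT(t)f(x)$ is measurable for every $f\in\mathcal{B}_b(E)$; (iv) there is a function $\varphi$ integrable in a neighbourhood of $0$ with $\|\hat BT(t)\|\le\varphi(t)$ for $t>0$. Let $S$ be the $\mathcal{C}_b$-semigroup of kernel operators whose full generator is $\hat A+\hat B=\{(u,f+\hat Bu):(u,f)\in\hat A\}$ (such $S$ exists under these hypotheses). Then: (a) If $\hat D$ is a bp-core for $\hat A$, then $\{(u,f+\hat Bu):(u,f)\in\hat D\}$ is a bp-core for $\hat A+\hat B$. (b) If $\hat BT(t)\mathcal{B}_\infty(E)\subset\mathcal{B}_\infty(E)$ for every $t>0$, then $S$ is a $\mathcal{C}_\infty$-semigroup.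
   Context: $\mathcal{B}_b(E)$, $\mathcal{C}_b(E)$, $\mathcal{C}_\infty(E)$: bounded Borel, bounded continuous, and continuous-vanishing-at-infinity functions with the sup norm. $\mathcal{B}_\infty(E)$: bounded Borel $f$ such that for every $\varepsilon>0$ there is a compact $K$ with $|f|\le\varepsilon$ off $K$. A kernel operator is $Tf(x)=\int f(y)k(x,dy)$ with $x\mapsto k(x,B)$ measurable, $k(x,\cdot)$ a signed measure, $\sup_x|k|(x,E)<\infty$. A semigroup of kernel operators of type $(M,\omega)$: kernel operators $(T(t))_{t>0}$ with $T(t+s)=T(t)T(s)$, $\|T(t)\|\le Me^{\omega t}$, $(t,x)\mapsto T(t)f(x)$ measurable. Laplace transform: $R(\lambda)f(x)=\int_0^\infty e^{-\lambda t}T(t)f(x)\,dt$. Full generator: $\hat A=\{(f,g): T(t)f-f=\int_0^tT(s)g\,ds\ \forall t>0\}$ (multivalued, $R(\lambda)=(\lambda-\hat A)^{-1}$); $D(\hat A)=\{u:\exists f,(u,f)\in\hat A\}$. Positive: each $T(t)\ge0$. $\mathcal{C}_\infty$-semigroup: $T(t)\mathcal{C}_\infty\subset\mathcal{C}_\infty$ and $\|T(t)f-f\|_\infty\to0$ as $t\to0$ for $f\in\mathcal{C}_\infty$. $\mathcal{C}_b$-semigroup: $T(t)\mathcal{C}_b\subset\mathcal{C}_b$ and $T(t)f\to f$ boundedly and pointwise as $t\to0$ for $f\in\mathcal{C}_b$. Strong Feller operator: maps $\mathcal{B}_b(E)$ into $\mathcal{C}_b(E)$. bp-convergence of a sequence: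 uniform boundedness plus pointwise convergence (componentwise for pairs). The bp-closure of a set is the smallest superset closed under bp-limits of sequences; $M\subset\hat A$ is a bp-core for $\hat A$ if its bp-closure in $\mathcal{B}_b\times\mathcal{B}_b$ equals $\hat A$. *)

(* Defs.v *)
From mathcomp Require Import all_boot all_order all_algebra.
From mathcomp Require Import all_classical all_reals all_analysis.
Set Implicit Arguments. Unset Strict Implicit. Unset Printing Implicit Defensive.
Import Order.TTheory GRing.Theory Num.Theory numFieldNormedType.Exports.
Local Open Scope classical_set_scope.
Local Open Scope ring_scope.

Section Defs.
Context {R : realType} {E : ptopologicalType}.

Definition polish_space : Prop :=
  (exists D : set E, countable D /\ closure D = setT) /\
  (exists d : E -> E -> R,
     (forall x y, 0 <= d x y) /\ (forall x y, d x y = 0 <-> x = y) /\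
     (forall x y, d x y = d y x) /\ (forall x y z, d x z <= d x y + d y z) /\
     (forall A : set E, open A <->
        (forall x, A x -> exists2 e : R, 0 < e & forall y, d x y < e -> A y)) /\
     (forall u : nat -> E,
        (forall e : R, 0 < e -> exists N, forall m n, (N <= m)%N -> (N <= n)%N ->
           d (u m) (u n) < e) ->
        exists l, forall e : R, 0 < e -> exists N, forall n, (N <= n)%N -> d (u n) l < e)).

Definition locally_compact_space : Prop := locally_compact [set: E].

Definition BE := g_sigma_algebraType (@open E).

Definition borel_fun (f : E -> R) : Prop := @measurable_fun _ _ BE R setT f.
Definition bounded_fun (f : E -> R) : Prop := exists C : R, forall x, `|f x| <= C.
Definition vanishes_at_infinity (f : E -> R) : Prop :=
  forall e : R, 0 < e -> exists K : set E, compact K /\ forall x, ~ K x -> `|f x| <= e.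

Definition Bb (f : E -> R) : Prop := borel_fun f /\ bounded_fun f.
Definition Cb (f : E -> R) : Prop := continuous f /\ bounded_fun f.
Definition Cinf (f : E -> R) : Prop := continuous f /\ vanishes_at_infinity f.
Definition Binf (f : E -> R) : Prop := Bb f /\ vanishes_at_infinity f.

Definition signed_measure (m : set BE -> R) : Prop :=
  m set0 = 0 /\
  forall F : nat -> set BE, (forall n, measurable (F n)) -> trivIset setT F ->
    (fun n => \sum_(i < n) m (F i)) @ \oo --> m (\bigcup_n F n).

Definition pos_var (m : set BE -> R) (B : set BE) : R :=
  sup [set m A | A in [set A | measurable A /\ A `<=` B]].
Definition neg_var (m : set BE -> R) (B : set BE) : R :=
  sup [set - m A | A in [set A | measurable A /\ A `<=` B]].
Definition tot_var (m : set BE -> R) (B : set BE) : R := pos_var m B + neg_var m B.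

Definition sintegral_signed (m : set BE -> R) (f : E -> R) : R :=
  fine (integral (fun B : set BE => (pos_var m B)%:E) setT (fun x : BE => (f x)%:E))
  - fine (integral (fun B : set BE => (neg_var m B)%:E) setT (fun x : BE => (f x)%:E)).

Definition kernel (k : E -> set BE -> R) : Prop :=
  (forall x, signed_measure (k x)) /\
  (forall B : set BE, measurable B -> borel_fun (fun x => k x B)) /\
  (exists C : R, forall x, tot_var (k x) setT <= C).

(** operators act on functions E -> R; only their action on B_b(E) matters *)
Definition op := (E -> R) -> (E -> R).

Definition kernel_op (K : op) : Prop :=
  exists k, kernel k /\ forall f, Bb f -> forall x, K f x = sintegral_signed (k x) f.

Definition opnorm_le (K : op) (c : R) : Prop :=
  forall f (r : R), Bb f -> (forall y, `|f y| <= r) -> forall x, `|K f x| <= c * r.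

Definition jointly_measurable (F : R -> E -> R) : Prop :=
  @measurable_fun _ _ (R * BE)%type R [set p | 0 < p.1] (fun p => F p.1 p.2).

Definition kernel_semigroup (T : R -> op) (M w : R) : Prop :=
  (forall t, 0 < t -> kernel_op (T t)) /\
  (forall t s, 0 < t -> 0 < s -> forall f, Bb f -> forall x, T (t + s) f x = T t (T s f) x) /\
  (forall t, 0 < t -> opnorm_le (T t) (M * expR (w * t))) /\
  (forall f, Bb f -> jointly_measurable (fun t => T t f)).

Definition positive_semigroup (T : R -> op) : Prop :=
  forall t, 0 < t -> forall f, Bb f -> (forall x, 0 <= f x) -> forall x, 0 <= T t f x.

Definition strong_feller (K : op) : Prop := forall f, Bb f -> Cb (K f).

Definition Cb_semigroup (T : R -> op) : Prop :=
  (forall t, 0 < t -> forall f, Cb f -> Cb (T t f)) /\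
  (forall f, Cb f ->
     (exists2 d : R, 0 < d & exists C : R, forall t, 0 < t < d -> forall x, `|T t f x| <= C) /\
     (forall x, (fun t => T t f x) @ at_right 0 --> f x)).

Definition Cinf_semigroup (T : R -> op) : Prop :=
  (forall t, 0 < t -> forall f, Cinf f -> Cinf (T t f)) /\
  (forall f, Cinf f -> forall e : R, 0 < e -> exists2 d : R, 0 < d &
     forall t, 0 < t < d -> forall x, `|T t f x - f x| <= e).

Definition laplace (T : R -> op) (l : R) : op := fun f x =>
  fine (integral (@lebesgue_measure R) `]0, +oo[
         (fun t => (expR (- (l * t)) * T t f x)%:E)).

(** full generator (a relation, i.e. a multivalued operator) *)
Definition full_generator (T : R -> op) : set ((E -> R) * (E -> R)) :=
  [set p | Bb p.1 /\ Bb p.2 /\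
     forall t, 0 < t -> forall x,
       integral (@lebesgue_measure R) `]0, t] (fun s => (T s p.2 x)%:E)
       = (T t p.1 x - p.1 x)%:E].

Definition rel_domain (A : set ((E -> R) * (E -> R))) : set (E -> R) :=
  [set u | exists f, A (u, f)].

Definition rel_add (A : set ((E -> R) * (E -> R))) (B : op) : set ((E -> R) * (E -> R)) :=
  [set p | exists u f, A (u, f) /\ p = (u, f \+ B u)].

Definition bp_conv (s : nat -> (E -> R) * (E -> R)) (p : (E -> R) * (E -> R)) : Prop :=
  (exists C : R, forall n x, `|(s n).1 x| <= C /\ `|(s n).2 x| <= C) /\
  (forall x, (fun n => (s n).1 x) @ \oo --> p.1 x) /\
  (forall x, (fun n => (s n).2 x) @ \oo --> p.2 x).

Definition bp_closed (S : set ((E -> R) * (E -> R))) : Prop :=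
  forall s p, (forall n, S (s n)) -> bp_conv s p -> S p.

Definition bp_closure (M : set ((E -> R) * (E -> R))) : set ((E -> R) * (E -> R)) :=
  [set p | forall S, M `<=` S -> bp_closed S -> S p].

Definition bp_core (A D : set ((E -> R) * (E -> R))) : Prop :=
  D `<=` A /\ bp_closure D = A.

Definition linear_on (D : set (E -> R)) (B : op) : Prop :=
  D (fun _ => 0) /\
  (forall (a : R) u v, D u -> D v ->
     D (fun x => a * u x + v x) /\ B (fun x => a * u x + v x) = (fun x => a * B u x + B v x)) /\
  (forall u, D u -> Bb (B u)).

End Defs.

(* Main.v *)
(** Write [R(l)] and [RS(l)] for the Laplace transforms (resolvents) of [T] and [S].

(a) For [(u, f)] in the generator of [T] one has [u = R(l) (l u - f)], so that
[B u = B R(l) (l u - f)], where [B R(l)] is a kernel operator, hence bp-continuous.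
Thus the pairs [(u, f)] such that [(u, f + B u)] lies in a given bp-closed set form
a bp-closed set.

(b) By a monotone class argument, [BT (t + s) = BT t \o T s] and
[B R(l) f = \int e^(-l t) BT t f dt] on all bounded Borel functions. Hence [B R(l)]
preserves [Binf] and its norm tends to [0] as [l] tends to infinity, so that the
identity [RS(l) = R(l) + RS(l) B R(l)], iterated, shows that [RS(l) f] vanishes at
infinity for [f] in [Binf], and that [l RS(l) f] tends uniformly to [f] for [f] in
[Cinf]; the range of [RS(l)] gives strong continuity at [0]. To return from [RS] to
[S p], put [rho t = 1 - (e^(-t) - e^(-p))^2], whose maximum is at [p]: the function
[\int e^(-l t) rho(t)^k S t u dt] is a linear combination of the [RS(l + j) u],
[0 <= j <= 2 k], and, once normalised, tends uniformly to [S p u] as [k] tends to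
infinity. *)

From HB Require Import structures.
Require Import Defs.
From mathcomp Require Import finmap.
From mathcomp Require Import all_boot all_order all_algebra.
From mathcomp Require Import all_classical all_reals all_analysis.
From mathcomp Require Import measurable_realfun simple_functions ring lra.
Set Implicit Arguments.
Unset Strict Implicit.
Unset Printing Implicit Defensive.
Import Order.TTheory GRing.Theory Num.Theory numFieldNormedType.Exports.
Local Open Scope classical_set_scope.
Local Open Scope ring_scope.

(** * Signed measures and kernel operators *)

Section signed_measures.
Context (R : realType) (E : ptopologicalType).
Local Notation BE := (@BE E).

(** [S] is accessible only through its generator, so everything said about [S t] has to be extracted
    from [RS(l)], which is pinned down by sending [l u - g] to [u] for each generator pair [(u, g)],
    even when the generator is multivalued. Vanishing at infinity of [RS(l) f] is available for
    large real [l] only, and an inversion must be uniform in the space variable. Powers of [rho]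
    meet the first constraint, since a factor [e^(-t)] moves [l] to the right by one. The second is
    met by taking [u] in the domain of the generator: its orbit is Lipschitz in time, with a
    constant independent of the point. Other functions of [Cinf] are uniform limits of such [u], and
    continuity of [S t f] is already part of being a [Cb] semigroup. On the side of [T], the
    operator [BT t] is tied to [B] on the domain only. Identities are checked there and carried over
    by bp-limits, the functions [(l + k) R(l + k) f] with [f] continuous providing bp-density. The
    bound [phi] is integrable only near [0], and the composition law for [BT] propagates it to all
    times. Positivity serves to pass from [Cinf] to the discontinuous functions of [Binf]. *)

Definition charge_of_signed (m : set BE -> R) of signed_measure m :=
  fun B : set BE => (m B)%:E.

Section charge_of_signed.
Variables (m : set BE -> R) (hm : signed_measure m).

Let charge_of_signed0 : charge_of_signed hm set0 = 0%E.
Proof. by rewrite /charge_of_signed hm.1. Qed.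

Let charge_of_signed_fin B : measurable B ->
  charge_of_signed hm B \is a fin_num.
Proof. by []. Qed.

Let charge_of_signed_sigma_additive : semi_sigma_additive (charge_of_signed hm).
Proof.
move=> F mF tF _.
rewrite [X in X @ _ --> _](_ : _ =
    EFin \o (fun n => \sum_(i < n) m (F i))); last first.
  by apply/funext => n /=; rewrite /charge_of_signed sumEFin big_mkord.
by apply: cvg_EFin; [exact: nearW|exact: hm.2].
Qed.

HB.instance Definition _ := isCharge.Build _ BE R (charge_of_signed hm)
  charge_of_signed0 charge_of_signed_fin charge_of_signed_sigma_additive.

End charge_of_signed.

Lemma sup_max (A : set R) a : A a -> ubound A a -> sup A = a.
Proof.
move=> Aa ua; apply/le_anti/andP; split.
  by apply: ge_sup => //; exists a.
by apply: ub_le_sup => //; exists a.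
Qed.

(** The suprema defining [pos_var] and [neg_var] are attained at the traces of [B] on the two sets
    of a Hahn decomposition, hence equal the Jordan parts. *)
Lemma signed_measure_jordan (m : set BE -> R) : signed_measure m ->
  exists p n : {finite_measure set BE -> \bar R}, forall B, measurable B ->
    (pos_var m B)%:E = p B /\ (neg_var m B)%:E = n B.
Proof.
move=> hm; pose nu : {charge set BE -> \bar R} := charge_of_signed hm.
have [P [N PN]] := Hahn_decomposition nu.
exists (jordan_pos PN), (jordan_neg PN) => B mB.
have [[mP posP] [mN negN] PUN PIN] := PN.
have add A C : measurable A -> measurable C -> A `&` C = set0 ->
    m (A `|` C) = m A + m C.
  move=> mA mC AC; apply: EFin_inj; rewrite EFinD -!/(nu _).
  by apply: (chargeU nu mA mC AC).
have split A : measurable A -> m A = m (A `&` P) + m (A `&` N).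
  move=> mA; rewrite -add; [|exact: measurableI|exact: measurableI|].
    by rewrite -setIUr PUN setIT.
  by rewrite setIACA PIN setI0.
have mono (Q A : set BE) : measurable Q -> measurable A -> A `<=` B ->
    m (B `&` Q) = m (A `&` Q) + m ((B `\` A) `&` Q).
  move=> mQ mA AB; rewrite -add.
  - by rewrite -setIUl setDUK.
  - exact: measurableI.
  - by apply: measurableI => //; exact: measurableD.
  - by rewrite setIACA setDIK set0I.
have pos0 A : measurable A -> 0 <= m (A `&` P).
  move=> mA; rewrite -lee_fin; apply: posP; first exact: measurableI.
  exact: subIsetr.
have neg0 A : measurable A -> m (A `&` N) <= 0.
  move=> mA; rewrite -lee_fin; apply: negN; first exact: measurableI.
  exact: subIsetr.
split.
- rewrite [RHS](jordan_posE PN B) cjordan_posE /crestr0 mem_set// /crestr /=.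
  congr EFin; apply: sup_max.
    by exists (B `&` P) => //; split; [exact: measurableI|exact: subIsetl].
  move=> _ [A [mA AB] <-]; rewrite (split A mA) (mono P A)//.
  rewrite lerD2l (le_trans (neg0 _ mA))//; apply: pos0; exact: measurableD.
- rewrite [RHS](jordan_negE PN B) cjordan_negE /crestr0 mem_set// /crestr /=.
  congr EFin; apply: sup_max.
    by exists (B `&` N) => //; split; [exact: measurableI|exact: subIsetl].
  move=> _ [A [mA AB] <-]; rewrite (split A mA) (mono N A)//.
  have := pos0 _ mA; have := neg0 _ (measurableD mB mA); lra.
Qed.

Import HBNNSimple.

(* [sintegral_signed] integrates against [pos_var] and [neg_var] as bare set
   functions, which are measures on the measurable sets only. *)
Lemma eq_set_fun_integral d (T : measurableType d) (mu nu : set T -> \bar R)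
    (D : set T) (f : T -> \bar R) :
  (forall A, measurable A -> mu A = nu A) ->
  integral mu D f = integral nu D f.
Proof.
move=> munu.
have mh (h : {nnsfun T >-> R}) (r : R) :
    d.-measurable ((h : T -> R) @^-1` [set r]).
  exact: measurable_funPTI.
rewrite /integral; congr (ereal_sup _ - ereal_sup _)%E;
  apply/seteqP; split => x [h hf <-]; exists h => //;
  by rewrite !sintegralET; apply: eq_fsbigr => r _; rewrite munu.
Qed.

Lemma sintegral_signed_jordan (m : set BE -> R) : signed_measure m ->
  exists p n : {finite_measure set BE -> \bar R},
    fine (p setT) + fine (n setT) = tot_var m setT /\
    forall f, sintegral_signed m f = \int[p]_x f x - \int[n]_x f x.
Proof.
move=> /signed_measure_jordan[p [n pn]]; exists p, n; split.
  by have [<- <-] := pn setT measurableT.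
move=> f; rewrite /sintegral_signed /Rintegral.
by congr (fine _ - fine _); apply: eq_set_fun_integral => A /pn[].
Qed.

End signed_measures.

Lemma cvgn_le (R : realType) (u : nat -> R) (l C : R) :
  u n @[n --> \oo] --> l -> (forall n, u n <= C) -> l <= C.
Proof.
move=> ul uC; rewrite -(cvg_lim _ ul)//; apply: limr_le; first exact: cvgP ul.
exact: nearW.
Qed.

Lemma norm_cvg_le (R : realType) (u : nat -> R) (l C : R) :
  u n @[n --> \oo] --> l -> (forall n, `|u n| <= C) -> `|l| <= C.
Proof. by move=> ul; apply: cvgn_le; apply: (cvg_norm ul). Qed.

Section bounded_integration.
Context d (T : measurableType d) (R : realType).

Lemma integrable_bounded (mu : {finite_measure set T -> \bar R}) (f : T -> R)
    (C : R) :
  measurable_fun setT f -> (forall x, `|f x| <= C) ->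
  mu.-integrable setT (EFin \o f).
Proof.
move=> mf fC; apply: measurable_bounded_integrable => //.
  by rewrite ltey_eq fin_num_measure.
exists C; split => [|r Cr x _]; first exact: num_real.
by rewrite /= (le_trans (fC x))// ltW.
Qed.

Lemma integrable_le (mu : {measure set T -> \bar R}) (D : set T) (f g : T ->
  R) :
  measurable D -> measurable_fun D f -> (forall x, D x -> `|f x| <= g x) ->
  mu.-integrable D (EFin \o g) -> mu.-integrable D (EFin \o f).
Proof.
move=> mD mf fg; apply: le_integrable => //; first exact/measurable_EFinP.
move=> x Dx /=; rewrite lee_fin (le_trans (fg _ Dx))//.
exact: ler_norm.
Qed.

Lemma Rintegral_dominated_cvg (mu : {measure set T -> \bar R}) (D : set T)
    (f_ : nat -> T -> R) (f g : T -> R) :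
  measurable D -> (forall n, measurable_fun D (f_ n)) ->
  (forall x, D x -> f_ n x @[n --> \oo] --> f x) ->
  mu.-integrable D (EFin \o g) ->
  (forall n x, D x -> `|f_ n x| <= g x) ->
  \int[mu]_(x in D) f_ n x @[n --> \oo] --> \int[mu]_(x in D) f x.
Proof.
move=> mD mf_ f_f ig f_g.
have mf : measurable_fun D f by apply: measurable_fun_cvg f_f.
have [_ _ cv] : [/\ mu.-integrable D (EFin \o f),
    [sequence \int[mu]_(x in D) `|(f_ n x)%:E - (f x)%:E|]_n @ \oo --> 0 &
    [sequence \int[mu]_(x in D) (f_ n x)%:E]_n @ \oo -->
      \int[mu]_(x in D) (f x)%:E]%E.
  apply: (@dominated_convergence _ _ _ mu D mD (fun n => EFin \o f_ n)
    (EFin \o f) (EFin \o g)) => //.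
  - by move=> n; exact/measurable_EFinP.
  - exact/measurable_EFinP.
  - by apply: aeW => x Dx; apply: cvg_EFin; [exact: nearW|exact: f_f].
  - by apply: aeW => x n Dx; rewrite /= lee_fin f_g.
have intf : mu.-integrable D (EFin \o f).
  apply: (integrable_le mD mf _ ig) => x Dx.
  by apply: (norm_cvg_le (f_f x Dx)) => n; exact: f_g.
apply: fine_cvg; rewrite fineK //; exact: integrable_fin_num.
Qed.

Lemma normr_Rintegral_le (mu : {measure set T -> \bar R}) (D : set T)
    (f g : T -> R) :
  measurable D -> measurable_fun D f -> (forall x, D x -> `|f x| <= g x) ->
  mu.-integrable D (EFin \o g) ->
  `|\int[mu]_(x in D) f x| <= \int[mu]_(x in D) g x.
Proof.
move=> mD mf fg ig; have intf := integrable_le mD mf fg ig.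
apply: (le_trans (le_normr_Rintegral mD intf)).
apply: le_Rintegral => //.
by apply: (integrable_le mD _ _ ig) => [|x Dx];
  [exact: measurableT_comp|rewrite normr_id fg].
Qed.

End bounded_integration.
Lemma integrable_mull d (T : measurableType d) (R : realType)
    (mu : {measure set T -> \bar R}) (D : set T) (r : R) (f : T -> R) :
  measurable D -> mu.-integrable D (EFin \o f) ->
  mu.-integrable D (EFin \o (fun x => r * f x)).
Proof.
move=> mD intf; rewrite (_ : _ \o _ = fun x => (r%:E * (EFin \o f) x)%E)//.
exact: integrableZl.
Qed.

Lemma integrable_mulr d (T : measurableType d) (R : realType)
    (mu : {measure set T -> \bar R}) (D : set T) (r : R) (f : T -> R) :
  measurable D -> mu.-integrable D (EFin \o f) ->
  mu.-integrable D (EFin \o (fun x => f x * r)).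
Proof.
move=> mD intf; rewrite (_ : (fun x => _) = fun x => r * f x).
  exact: integrable_mull.
by apply/funext => x; rewrite mulrC.
Qed.

Lemma integrable_norm_fun d (T : measurableType d) (R : realType)
    (mu : {measure set T -> \bar R}) (D : set T) (f : T -> R) :
  measurable D -> mu.-integrable D (EFin \o f) ->
  mu.-integrable D (EFin \o (fun x => `|f x|)).
Proof.
move=> mD intf; apply: (@le_integrable _ _ _ mu D mD _ (EFin \o f)) => //.
  apply/measurable_EFinP; apply: measurableT_comp => //.
  by apply/measurable_EFinP; exact: measurable_int intf.
by move=> x Dx /=; rewrite lee_fin normr_id.
Qed.

Section kernel_operators.
Context (R : realType) (E : ptopologicalType).
Local Notation BE := (@BE E).
Implicit Types (f g : E -> R) (K : @op R E).

Lemma borel_fun_lin a f g :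
  borel_fun f -> borel_fun g -> borel_fun (fun x => a * f x + g x).
Proof.
move=> mf mg; apply: measurable_funD => //.
exact: measurable_funM.
Qed.

Lemma Bb_lin a f g : Bb f -> Bb g -> Bb (fun x => a * f x + g x).
Proof.
move=> [mf [C fC]] [mg [D gD]]; split; first exact: borel_fun_lin.
exists (`|a| * C + D) => x; rewrite (le_trans (ler_normD _ _))// normrM.
by rewrite lerD// ler_wpM2l.
Qed.

Lemma Bb_cst (a : R) : Bb (fun _ : E => a).
Proof. by split; [exact: measurable_cst|exists `|a|]. Qed.

Lemma Bb_scale a f : Bb f -> Bb (fun x => a * f x).
Proof.
move=> Bf; rewrite (_ : (fun x => _) = fun x => a * f x + 0).
  exact: Bb_lin (Bb_cst 0).
by apply/funext => x; rewrite addr0.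
Qed.

Lemma Bb_cvg (f_ : nat -> E -> R) f C : (forall n, Bb (f_ n)) ->
  (forall n x, `|f_ n x| <= C) -> (forall x, f_ n x @[n --> \oo] --> f x) ->
  Bb f.
Proof.
move=> Bf fC ff; split.
  by apply: (@measurable_fun_cvg _ BE R setT f_) => // n; have [] := Bf n.
by exists C => x; apply: (norm_cvg_le (ff x)).
Qed.

(** The form in which kernel operators are used from here on: integration against two finite
    measures at each point, with masses bounded uniformly in the point. *)
Lemma kernel_op_jordan K : kernel_op K ->
  exists (p n : E -> {finite_measure set BE -> \bar R}) (C : R),
    (forall x, fine (p x setT) + fine (n x setT) <= C) /\
    forall f, Bb f -> forall x, K f x = \int[p x]_y f y - \int[n x]_y f y.
Proof.
move=> [k [[sk [_ [C kC]]] Kk]].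
have /choice[p /choice[n pn]] x := sintegral_signed_jordan (sk x).
exists p, n, C; split => [x|f Bf x]; first by have [-> _] := pn x.
by rewrite Kk//; have [_ ->] := pn x.
Qed.

Lemma integrable_Bb (mu : {finite_measure set BE -> \bar R}) f :
  Bb f -> mu.-integrable setT (EFin \o (f : BE -> R)).
Proof. by move=> [mf [C fC]]; apply: (@integrable_bounded _ BE R mu f C). Qed.

Lemma kernel_op_lin K a f g : kernel_op K -> Bb f -> Bb g ->
  K (fun x => a * f x + g x) = (fun x => a * K f x + K g x).
Proof.
move=> /kernel_op_jordan[p [n [C [_ Kpn]]]] Bf Bg; apply/funext => x.
rewrite !Kpn//; last exact: Bb_lin.
have lin (mu : {finite_measure set BE -> \bar R}) :
  \int[mu]_y (a * f y + g y) = a * (\int[mu]_y f y) + \int[mu]_y g y.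
  rewrite (@RintegralD _ BE R mu setT)//; last exact: integrable_Bb.
    by rewrite (@RintegralZl _ BE R mu setT)//; exact: integrable_Bb.
  by apply: (@integrable_Bb mu (fun x => a * f x)); exact: Bb_scale.
by rewrite !lin; lra.
Qed.

Lemma kernel_op_scale K a f : kernel_op K -> Bb f ->
  K (fun x => a * f x) = (fun x => a * K f x).
Proof.
move=> kK Bf; have K0 : K (fun=> 0) = fun=> 0.
  (* With [a = -1] and both functions zero, linearity reads [K 0 = - K 0 + K 0]. *)
  have := @kernel_op_lin K (-1) _ _ kK (Bb_cst 0) (Bb_cst 0).
  rewrite mulr0 addr0 => /funeqP e; apply/funext => x.
  by rewrite e/=; lra.
have := @kernel_op_lin K a _ _ kK Bf (Bb_cst 0).
rewrite K0 => e; rewrite (_ : (fun x => _) = fun x => a * f x + 0).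
  by rewrite e; apply/funext => x; rewrite addr0.
by apply/funext => x; rewrite addr0.
Qed.

(** Dominated convergence for each Jordan part, a constant being integrable for a finite measure.
    This bp-continuity is what lets identities between kernel operators pass to bp-limits. *)
Lemma kernel_op_cvg K (f_ : nat -> E -> R) f C : kernel_op K ->
  (forall n, Bb (f_ n)) -> (forall n x, `|f_ n x| <= C) ->
  (forall x, f_ n x @[n --> \oo] --> f x) ->
  forall x, K (f_ n) x @[n --> \oo] --> K f x.
Proof.
move=> /kernel_op_jordan[p [n [D [_ Kpn]]]] Bf fC ff x.
have Bfl := Bb_cvg Bf fC ff.
rewrite Kpn// (_ : (fun m => _) =
  fun m => \int[p x]_y f_ m y - \int[n x]_y f_ m y); last first.
  by apply/funext => m; rewrite Kpn.
have cv (mu : {finite_measure set BE -> \bar R}) :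
    \int[mu]_y f_ m y @[m --> \oo] --> \int[mu]_y f y.
  apply: (@Rintegral_dominated_cvg _ BE R mu setT f_ f (fun=> C)) => //.
  - by move=> m; have [] := Bf m.
  - by apply: (@integrable_Bb mu (fun=> C)); exact: Bb_cst.
by apply: cvgB; exact: cv.
Qed.

Lemma kernel_op_bounded K : kernel_op K -> exists2 c, 0 <= c & opnorm_le K c.
Proof.
move=> /kernel_op_jordan[p [n [D [pnD Kpn]]]]; exists D.
  by rewrite (le_trans _ (pnD point))// addr_ge0// fine_ge0.
move=> f r Bf fr x; rewrite Kpn//.
have bd (mu : {finite_measure set BE -> \bar R}) :
    `|\int[mu]_y f y| <= r * fine (mu setT).
  rewrite -(@Rintegral_cst _ BE R mu setT)//.
  apply: (@normr_Rintegral_le _ BE R mu setT f (fun=> r)) => //.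
    by have [] := Bf.
  by apply: (@integrable_Bb mu (fun=> r)); exact: Bb_cst.
rewrite (le_trans (ler_normB _ _))//.
have r0 : 0 <= r by rewrite (le_trans _ (fr point)).
have := bd (p x); have := bd (n x).
have := ler_wpM2l r0 (pnD x); lra.
Qed.

End kernel_operators.
Arguments kernel_op_cvg {R E K f_ f C} _ _ _ _ x.

(** * Time integrals *)

Section real_fubini.
Context d1 d2 (T1 : measurableType d1) (T2 : measurableType d2) (R : realType).
Variables (m1 : {sigma_finite_measure set T1 -> \bar R})
  (m2 : {sigma_finite_measure set T2 -> \bar R}).
Variables (f : T1 * T2 -> R) (g : T1 -> R) (h : T2 -> R).
Hypothesis mf : measurable_fun setT f.
Hypothesis fgh : forall x y, `|f (x, y)| <= g x * h y.
Hypothesis ig : m1.-integrable setT (EFin \o g).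
Hypothesis ih : m2.-integrable setT (EFin \o h).

(** A majorant of product form makes every section integrable, not just almost every one, so the
    inner integrals are finite at each point and [fine] loses nothing. *)
Lemma integrable_section1 x : m2.-integrable setT (fun y => (f (x, y))%:E).
Proof.
apply: (integrable_le _ _ (fun y _ => fgh x y)) => //.
  exact: measurable_fun_pair2.
exact: integrable_mull.
Qed.

Lemma integrable_section2 y : m1.-integrable setT (fun x => (f (x, y))%:E).
Proof.
apply: (integrable_le _ _ (fun x _ => fgh x y)) => //.
  exact: measurable_fun_pair1.
exact: integrable_mulr.
Qed.

Lemma integrable_product : (m1 \x m2)%E.-integrable setT (EFin \o f).
Proof.
apply/integrable12ltyP; first exact/measurable_EFinP.
have b x : (\int[m2]_y `|(f (x, y))%:E| <= (g x * \int[m2]_y h y)%:E)%E.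
  rewrite -RintegralZl//.
  have iz := integrable_mull (g x) measurableT ih.
  rewrite /Rintegral fineK; last exact: (integrable_fin_num measurableT iz).
  apply: ge0_le_integral => //.
  - apply/measurable_EFinP; apply: measurableT_comp => //.
    exact: measurable_fun_pair2.
  - exact: measurable_int iz.
  - by move=> y _; rewrite lee_fin.
have iz := integrable_mulr (\int[m2]_y h y) measurableT ig.
apply: (@le_lt_trans _ _ (\int[m1]_x `|(g x * \int[m2]_y h y)%:E|)%E);
  last first.
  by case/integrableP: iz.
apply: ge0_le_integral => //.
- by move=> x _; exact: integral_ge0.
- apply: (@measurable_fun_fubini_tonelli_F _ _ _ _ _ m2
    (fun p => `|(f p)%:E|)%E) => //.
  by apply/measurable_EFinP; exact: measurableT_comp.
- by apply: measurableT_comp => //; exact: measurable_int iz.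
- move=> x _; apply: (le_trans (b x)); rewrite lee_fin; exact: ler_norm.
Qed.

Lemma integral_section1E x :
  (\int[m2]_y (f (x, y))%:E = (\int[m2]_y f (x, y))%:E)%E.
Proof.
by rewrite /Rintegral fineK//; apply: integrable_fin_num => //;
  exact: integrable_section1.
Qed.

Lemma integral_section2E y :
  (\int[m1]_x (f (x, y))%:E = (\int[m1]_x f (x, y))%:E)%E.
Proof.
by rewrite /Rintegral fineK//; apply: integrable_fin_num => //;
  exact: integrable_section2.
Qed.

Lemma measurable_Rintegral1 :
  measurable_fun setT (fun x => \int[m2]_y f (x, y)).
Proof.
apply/measurable_EFinP.
rewrite (_ : _ \o _ = fubini_F m2 (EFin \o f)).
  exact: measurable_fubini_F integrable_product.
by apply/funext => x; rewrite /fubini_F /= integral_section1E.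
Qed.

Lemma measurable_Rintegral2 :
  measurable_fun setT (fun y => \int[m1]_x f (x, y)).
Proof.
apply/measurable_EFinP.
rewrite (_ : _ \o _ = fubini_G m1 (EFin \o f)).
  exact: measurable_fubini_G integrable_product.
by apply/funext => y; rewrite /fubini_G /= integral_section2E.
Qed.

Lemma Rintegral_fubini :
  \int[m1]_x \int[m2]_y f (x, y) = \int[m2]_y \int[m1]_x f (x, y).
Proof.
rewrite [LHS]/Rintegral [RHS]/Rintegral; congr fine.
have := Fubini integrable_product; rewrite /=.
under eq_integral do rewrite integral_section1E.
by under [RHS]eq_integral do rewrite integral_section2E.
Qed.

End real_fubini.

(** * Exponential integrals, translations and conditional integrands *)

Section exponential_integrals.
Context (R : realType).
Local Notation mu := (@lebesgue_measure R).

Lemma cvg_expRN_pinfty (c : R) : 0 < c -> expR (- (c * x)) @[x --> +oo] --> 0.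
Proof.
move=> c0.
rewrite (_ : (fun x => _) = (fun z => expR (- z)) \o (fun z => c * z))//.
apply: (@cvg_comp _ _ _ _ _ _ (pinfty_nbhs R)); last exact: cvgr_expR.
exact: gt0_cvgMry.
Qed.

Lemma integral_expRN (c a : R) : 0 < c ->
  (\int[mu]_(x in `]a, +oo[) (expR (- (c * x)))%:E)%E = (expR (- (c * a)) /
    c)%:E.
Proof.
move=> c0.
have cexp : continuous (fun x : R => expR (- (c * x))).
  move=> x; apply: continuous_comp; last exact: continuous_expR.
  by apply: continuousN; apply: continuousM => //; exact: cst_continuous.
have dexp (x : R) : is_derive x 1 (fun x : R =>
  - (c^-1 * expR (- (c * x)))) (expR (- (c * x))).
  apply: is_derive_eq; rewrite /GRing.scale /= mulr1.
  by rewrite mulrN mulrN opprK; field; rewrite gt_eqF.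
rewrite integral_itv_obnd_cbnd; last first.
  by apply/measurable_EFinP; apply: measurable_funTS;
    exact: continuous_measurable_fun.
rewrite (@ge0_continuous_FTC2y _ _ (fun x =>
  - (c^-1 * expR (- (c * x)))) _ 0)//.
- by rewrite -EFinN -EFinD opprK add0r mulrC.
- by apply: continuous_subspaceT.
- rewrite -oppr0; apply: cvgN; rewrite -(mulr0 c^-1).
  by apply: cvgMl_tmp; exact: cvg_expRN_pinfty.
- apply: cvg_at_right_filter; apply: cvgN; apply: cvgMl_tmp; exact: cexp.
- by move=> x _; rewrite derive1E (@derive_val _ _ _ _ _ _ _ (dexp x)).
Qed.

Lemma Rintegral_expRN (c a : R) : 0 < c ->
  \int[mu]_(x in `]a, +oo[) expR (- (c * x)) = expR (- (c * a)) / c.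
Proof. by move=> c0; rewrite /Rintegral integral_expRN. Qed.

Lemma integrable_expRN (c a : R) : 0 < c ->
  mu.-integrable `]a, +oo[ (EFin \o (fun x => expR (- (c * x)))).
Proof.
move=> c0; apply/integrableP; split.
  apply/measurable_EFinP; apply: measurable_funTS.
  by apply: measurableT_comp => //; apply: measurableT_comp => //;
    exact: measurable_funM.
under eq_integral do rewrite gee0_abs ?lee_fin ?expR_ge0//.
by rewrite integral_expRN// ltry.
Qed.

End exponential_integrals.

Section shift.
Context (R : realType).
Local Notation mu := (@lebesgue_measure R).

(** The pushforward under a translation agrees with Lebesgue measure on half-open intervals, and
    these determine it. *)
Lemma lebesgue_measure_shift (s : R) (A : set R) : measurable A ->
  mu ((fun t => t + s) @^-1` A) = mu A.
Proof.
move=> mA.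
have ms : measurable_fun [set: measurableTypeR R] (fun t : R => t + s).
  exact: measurable_funD.
pose nu : {measure set (measurableTypeR R) -> \bar R} :=
  @measure_function_pushforward__canonical__measure_function_Measure
      _ _ (measurableTypeR R) (measurableTypeR R) R mu (fun t => t + s) ms.
rewrite -[LHS]/(nu A); apply/esym/lebesgue_measure_unique => //.
move=> _ [[a b] _ <-] /=.
rewrite /pushforward (_ : _ @^-1` _ = `]a - s, b - s]%classic).
  rewrite !lebesgue_measure_itv /= !lte_fin ltrD2r.
  by case: ifP => // _; rewrite -!EFinB; congr EFin; lra.
apply/seteqP; split => x /=; rewrite !in_itv/=; lra.
Qed.

Lemma Rintegral_shift (f : R -> R) (s : R) : 0 <= s ->
  mu.-integrable `]0, +oo[ (EFin \o f) ->
  mu.-integrable `]0, +oo[ (fun t => (f (t + s))%:E) /\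
  \int[mu]_(t in `]0, +oo[) f (t + s) = \int[mu]_(t in `]s, +oo[) f t.
Proof.
move=> s0 intf.
pose phi : measurableTypeR R -> measurableTypeR R := fun t : R => t + s.
have ms : measurable_fun [set: measurableTypeR R] phi.
  exact: measurable_funD.
have pre : phi @^-1` `]s, +oo[ = `]0, +oo[%classic.
  by apply/seteqP; split => x /=; rewrite /phi !in_itv/= !andbT; lra.
have sub : `]s, +oo[ `<=` `]0, +oo[%classic.
  by move=> x /=; rewrite !in_itv/= !andbT; lra.
(* [f] is controlled on the positive half-line only; its extension by [0] is measurable on the whole
   line, as the change of variables requires. *)
pose f0 : R -> R := f \_ `]0, +oo[.
have mf0 : measurable_fun setT f0.
  apply/(measurable_restrictT _ _).1 => //.
  by apply/measurable_EFinP; exact: measurable_int intf.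
have f0E t : 0 < t -> f0 t = f t.
  by move=> t0; rewrite /f0 patchE mem_set//= in_itv/= t0.
have munu (g : R -> \bar R) : (\int[mu]_(t in `]s, +oo[) g t =
    \int[pushforward mu phi]_(t in `]s, +oo[) g t)%E.
  pose nu : {measure set (measurableTypeR R) -> \bar R} :=
    @measure_function_pushforward__canonical__measure_function_Measure
      _ _ (measurableTypeR R) (measurableTypeR R) R mu phi ms.
  rewrite -[RHS]/(\int[nu]_(t in `]s, +oo[) g t)%E.
  apply: eq_measure_integral => A mA _.
  exact/esym/lebesgue_measure_shift.
have intfs : mu.-integrable `]0, +oo[ (EFin \o f0 \o phi).
  apply/integrableP; split.
    apply: measurable_funTS; apply: measurableT_comp => //.
    exact/measurable_EFinP.
  rewrite -pre.
  rewrite -[ltLHS](@ge0_integral_pushforward _ _ _ _ _ _ ms mu _ (fun t =>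
    `|(f0 t)%:E|)%E)//.
  + rewrite -munu; have /integrableP[_] : mu.-integrable `]s, +oo[ (EFin \o f).
      exact: integrableS intf.
    apply: le_lt_trans; rewrite le_eqVlt; apply/orP; left; apply/eqP.
    apply: eq_integral => t; rewrite inE/= in_itv/= andbT => st.
    by rewrite f0E// (le_lt_trans s0).
  + by apply: measurable_funTS; apply: measurableT_comp => //;
    exact/measurable_EFinP.
split.
  apply: eq_integrable intfs => // t; rewrite inE/= in_itv/= andbT => t0.
  by rewrite f0E// ltr_wpDr.
transitivity (\int[mu]_(t in `]0, +oo[) f0 (t + s)).
  apply: eq_Rintegral => t; rewrite inE/= in_itv/= andbT => t0.
  by rewrite f0E// ltr_wpDr.
transitivity (\int[mu]_(t in `]s, +oo[) f0 t); last first.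
  apply: eq_Rintegral => t; rewrite inE/= in_itv/= andbT => t0.
  by rewrite f0E// (le_lt_trans s0).
rewrite /Rintegral munu; congr fine; rewrite -pre.
rewrite integral_pushforward//; first exact/measurable_EFinP.
by rewrite pre.
Qed.

End shift.

Section conditional.
Context d (T : measurableType d) (R : realType) (mu : {measure set T ->
  \bar R}).
Variables (D : set T) (P : T -> bool) (DP : forall x, D x <-> P x).

Lemma restrict_ifE (f : T -> R) : f \_ D = fun x => if P x then f x else 0.
Proof.
apply/funext => x; rewrite patchE; case: ifPn => [|/negP xD].
  by rewrite inE => /DP ->.
by case: ifPn => // /DP /mem_set.
Qed.

(** Writing the domain as a boolean test inside the integrand lets Fubini be applied on a full
    product even when the range of one variable depends on the other. *)
Lemma Rintegral_if (f : T -> R) :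
  \int[mu]_(x in D) f x = \int[mu]_x (if P x then f x else 0).
Proof. by rewrite Rintegral_mkcond restrict_ifE. Qed.

Lemma measurable_if (f : T -> R) : measurable D ->
  measurable_fun D f <-> measurable_fun setT (fun x => if P x then f x else 0).
Proof. by move=> mD; rewrite -restrict_ifE; exact: measurable_restrictT. Qed.

Lemma integrable_if (f : T -> R) : measurable D ->
  mu.-integrable D (EFin \o f) <->
  mu.-integrable setT (EFin \o (fun x => if P x then f x else 0)).
Proof.
by move=> mD; rewrite -restrict_ifE -restrict_EFin; exact: integrable_mkcond.
Qed.

End conditional.

(** * Scalar Laplace transforms *)

Section scalar_laplace.
Context (R : realType).
Local Notation mu := (@lebesgue_measure R).
Implicit Types (h F : R -> R) (l w C t : R).

(** Restricted to positive times because an orbit [t |-> S t f x] carries no information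
    elsewhere. *)
Definition exp_bounded h C w : Prop :=
  measurable_fun (`]0, +oo[%classic : set R) h /\ forall t, 0 < t ->
    `|h t| <= C * expR (w * t).

Let pos_if (t : R) : `]0, +oo[%classic t <-> (0 < t).
Proof. by rewrite /= in_itv/= andbT. Qed.

Let ge_if (s t : R) : `[s, +oo[%classic t <-> (s <= t).
Proof. by rewrite /= in_itv/= andbT. Qed.

Let oc_if (s t : R) : `]0, s]%classic t <-> (0 < t <= s).
Proof. by rewrite /= in_itv/=. Qed.

Lemma measurable_expR_lin (c : R) (D : set R) :
  measurable_fun D (fun t : R => expR (c * t)).
Proof. by apply: measurable_funTS; apply: measurableT_comp. Qed.

Lemma measurable_expRN (c : R) (D : set R) :
  measurable_fun D (fun t : R => expR (- (c * t))).
Proof.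
by apply: measurable_funTS; apply: measurableT_comp => //;
  apply: measurableT_comp.
Qed.

Lemma exp_bounded_integrable h C w l : exp_bounded h C w -> w < l ->
  mu.-integrable `]0, +oo[ (EFin \o (fun t => expR (- (l * t)) * h t)).
Proof.
move=> [mh hb] wl; have lw : 0 < l - w by lra.
apply: (integrable_le _ _ _ (integrable_mull C _ (integrable_expRN 0 lw))) =>
  //.
  by apply: measurable_funM => //; exact: measurable_expRN.
move=> t /pos_if t0; rewrite normrM (ger0_norm (expR_ge0 _)).
apply: (le_trans (ler_wpM2l (expR_ge0 _) (hb _ t0))).
rewrite mulrCA -expRD le_eqVlt; apply/orP; left; apply/eqP;
  congr (_ * expR _); lra.
Qed.

Lemma exp_bounded_integrable_oc h C w t : exp_bounded h C w ->
  mu.-integrable `]0, t] (EFin \o h).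
Proof.
(* Any [l] above both [0] and [w] would do: on the interval [h] is at most [expR (l * t)] times the
   integrable [expR (- (l * s)) * h s] in absolute value. *)
move=> hb; pose l := Num.max 0 w + 1.
have [l0 wl] : 0 < l /\ w < l by rewrite /l; case: (lerP 0 w) => ?; split; lra.
have sub : (`]0, t]%classic : set R) `<=` `]0, +oo[%classic.
  by move=> s /=; rewrite !in_itv/= andbT => /andP[].
have ih : mu.-integrable `]0, t] (EFin \o (fun s => expR (- (l * s)) * h s)).
  apply: integrableS (exp_bounded_integrable hb wl) => //.
have mI : measurable (`]0, t]%classic : set (measurableTypeR R)) by [].
have ih' := integrable_mull (expR (l * t)) mI (integrable_norm_fun mI ih).
apply: (integrable_le mI _ _ ih'); first exact: measurable_funS hb.1.
move=> s /oc_if /andP[s0 st].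
rewrite normrM (ger0_norm (expR_ge0 _)) mulrA -expRD ler_peMl// -expR0 ler_expR.
by have := ler_wpM2l (ltW l0) st; lra.
Qed.

Lemma exp_bounded_norm h C w l : exp_bounded h C w -> w < l ->
  `|\int[mu]_(t in `]0, +oo[) (expR (- (l * t)) * h t)| <= C / (l - w).
Proof.
move=> hb wl; have lw : 0 < l - w by lra.
apply: (@le_trans _ _ (\int[mu]_(t in `]0, +oo[) (C * expR (- ((l - w) * t))))).
  apply: normr_Rintegral_le => //.
  - by apply: measurable_funM => //; [exact: measurable_expRN|exact: hb.1].
  - move=> t /pos_if t0; rewrite normrM (ger0_norm (expR_ge0 _)).
    apply: (le_trans (ler_wpM2l (expR_ge0 _) (hb.2 _ t0))).
    rewrite mulrCA -expRD le_eqVlt; apply/orP; left; apply/eqP.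
    congr (_ * expR _); lra.
  - exact: integrable_mull (integrable_expRN 0 lw).
rewrite RintegralZl//; last exact: integrable_expRN.
by rewrite Rintegral_expRN// mulr0 oppr0 expR0 mul1r.
Qed.

Lemma exp_bounded_ge0 h C w : exp_bounded h C w -> 0 <= C.
Proof.
move=> [_ /(_ 1 ltr01)]; rewrite mulr1 => b.
by rewrite -(pmulr_lge0 _ (expR_gt0 w)) (le_trans _ b).
Qed.

Lemma Rintegral0 d (T : measurableType d) (nu : {measure set T -> \bar R})
    (D : set T) : measurable D -> \int[nu]_(x in D) (0 : R) = 0.
Proof. by move=> mD; rewrite Rintegral_cst// mul0r. Qed.

(** Fubini on the triangle [0 < s <= t], the integral of [l * expR (- (l * t))] from [s] to infinity
    being [expR (- (l * s))]. *)
Lemma laplace_primitive h C w l : exp_bounded h C w -> w < l -> 0 < l ->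
  \int[mu]_(t in `]0, +oo[) (l * expR (- (l * t)) * \int[mu]_(s in `]0, t]) h s)
    = \int[mu]_(s in `]0, +oo[) (expR (- (l * s)) * h s).
Proof.
move=> hb wl l0; have C0 := exp_bounded_ge0 hb.
(* A rate strictly between [max 0 w] and [l] splits the exponential: for [s <= t],
   [expR (- (l * t)) * expR (w * s)] is at most [expR (- ((l - v) * t)) * expR (- ((v - w) * s))], a
   product of integrable functions. *)
pose v := (Num.max 0 w + l) / 2.
have [v0 wv vl] : [/\ 0 < v, w < v & v < l].
  by rewrite /v; case: (lerP 0 w) => ?; split; lra.
pose h0 (s : R) : R := if 0 < s then h s else 0.
pose f (p : R * R) : R :=
  if p.2 <= p.1 then l * expR (- (l * p.1)) * h0 p.2 else 0.
pose g (t : R) : R := if 0 < t then l * expR (- ((l - v) * t)) else 0.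
pose k (s : R) : R := if 0 < s then C * expR (- ((v - w) * s)) else 0.
have mh : measurable_fun setT h0.
  by apply/(measurable_if pos_if) => //; exact: hb.1.
have mf : @measurable_fun _ _ (measurableTypeR R * measurableTypeR R)%type R
  setT f.
  change (measurable_fun setT f).
  apply: measurable_fun_ifT;
    [exact: measurable_fun_ler| |exact: measurable_cst].
  apply: measurable_funM; last exact: measurableT_comp.
  apply: measurable_funM => //; apply: measurableT_comp => //.
  by apply: measurableT_comp => //; exact: measurable_funM.
have fgk t s : `|f (t, s)| <= g t * k s.
  rewrite /f /g /k /h0 /=; case: (ltrP 0 s) => s0; last first.
    by rewrite !mulr0 if_same normr0.
  case: (lerP s t) => st; last first.
    rewrite normr0; case: ifP => _; last by rewrite mul0r.
    by rewrite !mulr_ge0// ?expR_ge0// ltW.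
  rewrite (lt_le_trans s0 st) !normrM (gtr0_norm l0) (ger0_norm (expR_ge0 _)).
  rewrite -!mulrA; apply: ler_wpM2l; first exact: ltW.
  apply: (le_trans (ler_wpM2l (expR_ge0 _) (hb.2 _ s0))).
  rewrite [leLHS]mulrCA [leRHS]mulrCA ler_wpM2l// -!expRD ler_expR.
  have : v * s <= v * t by rewrite ler_wpM2l// ltW.
  lra.
have ig : mu.-integrable setT (EFin \o g).
  apply/(integrable_if mu pos_if) => //; apply: integrable_mull => //.
  by apply: integrable_expRN; lra.
have ik : mu.-integrable setT (EFin \o k).
  apply/(integrable_if mu pos_if) => //; apply: integrable_mull => //.
  by apply: integrable_expRN; lra.
rewrite (Rintegral_if mu pos_if) [RHS](Rintegral_if mu pos_if).
transitivity (\int[mu]_x \int[mu]_y f (x, y));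
  [|rewrite (Rintegral_fubini mf fgk ig ik)].
- apply: eq_Rintegral => t _; rewrite /f/=.
  case: ltrP => t0; last first.
    rewrite -[LHS](Rintegral0 mu (@measurableT _ R)).
    apply: eq_Rintegral => s _; case: ifP => // st.
    by rewrite /h0 ltNge (le_trans st)//= mulr0.
  rewrite (Rintegral_if mu (oc_if t)) -RintegralZl//; last first.
    apply/(integrable_if mu (oc_if t)) => //.
    exact: exp_bounded_integrable_oc hb.
  apply: eq_Rintegral => s _; rewrite /h0.
  by case: (ltrP 0 s) => //= s0; case: ifP => //; rewrite mulr0.
- apply: eq_Rintegral => s _; rewrite /f/= /h0.
  case: ltrP => s0; last first.
    rewrite -[RHS](Rintegral0 mu (@measurableT _ R)).
    by apply: eq_Rintegral => t _; rewrite mulr0 if_same.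
  transitivity (\int[mu]_(t in `[s, +oo[) (l * expR (- (l * t)) * h s)).
    by rewrite (Rintegral_if mu (ge_if s)).
  rewrite -Rintegral_itv_obnd_cbnd; last first.
    by apply: integrable_mulr => //; apply: integrable_mull => //;
      exact: integrable_expRN.
  rewrite RintegralZr//; last by apply: integrable_mull => //;
    exact: integrable_expRN.
  rewrite RintegralZl//; last exact: integrable_expRN.
  by rewrite Rintegral_expRN// mulrCA divff ?gt_eqF// mulr1.
Qed.

End scalar_laplace.

Section scalar_resolvent.
Context (R : realType).
Local Notation mu := (@lebesgue_measure R).
Implicit Types (h F : R -> R) (l w C t : R).

Let pos_if (t : R) : `]0, +oo[%classic t <-> (0 < t).
Proof. by rewrite /= in_itv/= andbT. Qed.

Let ge_if (s t : R) : `[s, +oo[%classic t <-> (s <= t).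
Proof. by rewrite /= in_itv/= andbT. Qed.

Let oc_if (s t : R) : `]0, s]%classic t <-> (0 < t <= s).
Proof. by rewrite /= in_itv/=. Qed.

Lemma integrable_expR_oc (l a : R) :
  mu.-integrable `]0, a] (EFin \o (fun s => expR (l * s))).
Proof.
apply: exp_bounded_integrable_oc (_ : exp_bounded _ 1 l); split.
  exact: measurable_expR_lin.
by move=> t _; rewrite mul1r ger0_norm// expR_ge0.
Qed.

Lemma Rintegral_expR_oc (l a : R) : 0 < a ->
  \int[mu]_(s in `]0, a]) (l * expR (l * s)) = expR (l * a) - 1.
Proof.
move=> a0.
have cexp : continuous (fun x : R => expR (l * x)).
  move=> x; apply: continuous_comp; last exact: continuous_expR.
  by apply: continuousM => //; exact: cst_continuous.
have clexp : continuous (fun x : R => l * expR (l * x)).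
  by move=> x; apply: cvgMl_tmp; exact: cexp.
rewrite Rintegral_itv_obnd_cbnd; last first.
  exact: integrable_mull (integrable_expR_oc l a).
rewrite /Rintegral (@continuous_FTC2 _ _ (fun x => expR (l * x)))//.
- by rewrite mulr0 expR0.
- exact: continuous_subspaceT.
- split.
  + by move=> z _; exact: ex_derive.
  + by apply: cvg_at_right_filter; exact: cexp.
  + by apply: cvg_at_left_filter; exact: cexp.
- move=> x _; rewrite derive1E.
  have dexp : is_derive x 1 (fun x : R => expR (l * x)) (l * expR (l * x)).
    by apply: is_derive_eq; rewrite /GRing.scale /= mulr1 mulrC.
  by rewrite derive_val.
Qed.

Lemma Rintegral_pos_split (f : R -> R) (a : R) : 0 < a ->
  mu.-integrable `]0, +oo[ (EFin \o f) ->
  \int[mu]_(t in `]0, +oo[) f t =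
  \int[mu]_(t in `]0, a]) f t + \int[mu]_(t in `]a, +oo[) f t.
Proof.
move=> a0 intf; rewrite -(Rintegral_itvB intf (x := a)) ?bnd_simp ?ltW//.
by rewrite addrC subrK.
Qed.

Lemma exp_bounded_integrable_oy h C w l a : exp_bounded h C w -> w < l ->
  0 <= a ->
  mu.-integrable `]a, +oo[ (EFin \o (fun t => expR (- (l * t)) * h t)).
Proof.
move=> hb wl a0; apply: integrableS (exp_bounded_integrable hb wl) => //.
by move=> s /=; rewrite !in_itv/= !andbT; exact: le_lt_trans.
Qed.

(** Fubini on [s <= r], [s <= t]: the integral in [s] runs up to [min r t] and equals
    [expR (l * min r t) - 1], after which the integral in [r] is cut at [t]. For an orbit [h] this
    is the generator equation of a resolvent. *)
Lemma resolvent_primitive h C w l t : exp_bounded h C w -> w < l -> 0 < l ->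
  0 < t ->
  \int[mu]_(s in `]0, t])
    (l * expR (l * s) * \int[mu]_(r in `]s, +oo[) (expR (- (l * r)) * h r)) =
  \int[mu]_(r in `]0, t]) h r +
  expR (l * t) * \int[mu]_(r in `]t, +oo[) (expR (- (l * r)) * h r) -
  \int[mu]_(r in `]0, +oo[) (expR (- (l * r)) * h r).
Proof.
move=> hb wl l0 t0.
pose k (r : R) : R := if 0 < r then expR (- (l * r)) * h r else 0.
pose g (s : R) : R := if 0 < s <= t then l * expR (l * s) else 0.
pose f (p : R * R) : R := if p.1 <= p.2 then g p.1 * k p.2 else 0.
have ih := exp_bounded_integrable hb wl.
have ik : mu.-integrable setT (EFin \o k) by apply/(integrable_if mu pos_if).
have ig : mu.-integrable setT (EFin \o g).
  apply/(integrable_if mu (oc_if t)) => //.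
  exact: integrable_mull (integrable_expR_oc l t).
have mf : @measurable_fun _ _ (measurableTypeR R * measurableTypeR R)%type R
  setT f.
  change (measurable_fun setT f).
  apply: measurable_fun_ifT;
    [exact: measurable_fun_ler| |exact: measurable_cst].
  apply: measurable_funM; apply: measurableT_comp => //.
    by apply/measurable_EFinP; exact: measurable_int ig.
  by apply/measurable_EFinP; exact: measurable_int ik.
have g0 s : 0 <= g s.
  by rewrite /g; case: ifP => // _; rewrite mulr_ge0 ?expR_ge0// ltW.
have fgk s r : `|f (s, r)| <= g s * `|k r|.
  rewrite /f/=; case: ifP => _; first by rewrite normrM ger0_norm.
  by rewrite normr0 mulr_ge0.
have ik' := integrable_norm_fun measurableT ik.
have gE a : 0 < a -> a <= t -> \int[mu]_(s in `]0, a]) g s = expR (l * a) - 1.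
  move=> a0 at_; rewrite -Rintegral_expR_oc//; apply: eq_Rintegral => s.
  by rewrite inE/= in_itv/= /g => /andP[-> sa]; rewrite (le_trans sa at_).
transitivity (\int[mu]_s \int[mu]_r f (s, r)).
  rewrite (Rintegral_if mu (oc_if t)); apply: eq_Rintegral => s _.
  rewrite /f/= /g; case: ifPn => [/andP[s0 st]|_]; last first.
    rewrite -[LHS](Rintegral0 mu (@measurableT _ (measurableTypeR R))).
    by apply: eq_Rintegral => r _; rewrite mul0r if_same.
  rewrite Rintegral_itv_obnd_cbnd; last first.
    by apply: exp_bounded_integrable_oy hb wl _; exact: ltW.
  rewrite -RintegralZl//; last first.
    apply: integrableS ih => // r; rewrite /= !in_itv/= !andbT;
      exact: lt_le_trans.
  rewrite (Rintegral_if mu (ge_if s)); apply: eq_Rintegral => r _.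
  by case: ifP => // sr; rewrite /k (lt_le_trans s0 sr).
rewrite (Rintegral_fubini mf fgk ig ik').
transitivity (\int[mu]_(r
  in `]0, +oo[) ((expR (l * Num.min r t) - 1) * (expR (- (l * r)) * h r))).
  rewrite (Rintegral_if mu pos_if); apply: eq_Rintegral => r _.
  rewrite /f/= /k; case: ifP => r0; last first.
    rewrite -[RHS](Rintegral0 mu (@measurableT _ (measurableTypeR R))).
    by apply: eq_Rintegral => s _; rewrite mulr0 if_same.
  have m0 : 0 < Num.min r t by rewrite lt_min r0.
  rewrite -gE ?ge_min ?lexx ?orbT// -RintegralZr//; last first.
    by apply: integrableS ig.
  rewrite (Rintegral_if mu (oc_if _)); apply: eq_Rintegral => s _.
  rewrite /g le_min; case: (ltrP 0 s) => //= s0.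
    by case: ifP => // _; case: ifP => // _; rewrite mul0r.
  by rewrite mul0r if_same.
have ih2 : mu.-integrable `]0, +oo[ (EFin \o (fun r : R =>
    (expR (l * Num.min r t) - 1) * (expR (- (l * r)) * h r))).
  apply: (integrable_le _ _ _ (integrable_mull (expR (l * t) + 1) _
    (integrable_norm_fun _ ih))) => //.
    apply: measurable_funM.
      apply: measurable_funB => //; apply: measurable_funTS.
      apply: measurableT_comp => //; apply: measurable_funM => //.
      exact: measurable_minr.
    by apply/measurable_EFinP; exact: measurable_int ih.
  move=> r _; rewrite normrM ler_wpM2r// (le_trans (ler_normB _ _))//.
  rewrite normr1 lerD2r ger0_norm ?expR_ge0// ler_expR.
  by apply: ler_wpM2l; [exact: ltW|]; rewrite ge_min lexx orbT.
rewrite (Rintegral_pos_split t0 ih2) (Rintegral_pos_split t0 ih).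
have -> : \int[mu]_(r in `]0,
  t]) ((expR (l * Num.min r t) - 1) * (expR (- (l * r)) * h r))
  = \int[mu]_(r in `]0, t]) (h r - expR (- (l * r)) * h r).
  apply: eq_Rintegral => r; rewrite inE/= in_itv/= => /andP[r0 rt].
  by rewrite min_l// mulrBl mul1r mulrA -expRD subrr expR0 mul1r.
have -> : \int[mu]_(r in `]t,
  +oo[) ((expR (l * Num.min r t) - 1) * (expR (- (l * r)) * h r))
  = \int[mu]_(r in `]t, +oo[) ((expR (l * t) - 1) * (expR (- (l * r)) * h r)).
  apply: eq_Rintegral => r; rewrite inE/= in_itv/= andbT => rt.
  by rewrite min_r// ltW.
rewrite RintegralB//; last 2 first.
  exact: exp_bounded_integrable_oc hb.
  by apply: integrableS ih => // r; rewrite /= !in_itv/= => /andP[->].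
rewrite RintegralZl//; last by apply: exp_bounded_integrable_oy hb wl _;
  exact: ltW.
lra.
Qed.

End scalar_resolvent.

(** * Kernel operators under time integrals *)

Section time_integrals.
Context (R : realType) (E : ptopologicalType).
Local Notation BE := (@BE E).
Local Notation mu := (@lebesgue_measure R).
Implicit Types (F : R -> E -> R) (b : R -> R) (K : @op R E) (t : R).

Let pos_if (t : R) : `]0, +oo[%classic t <-> (0 < t).
Proof. by rewrite /= in_itv/= andbT. Qed.

Lemma measurable_pos_time : measurable [set p : R * BE | 0 < p.1].
Proof.
rewrite (_ : [set _ | _] = fst @^-1` [set` `]0, +oo[]).
  rewrite -[X in measurable X]setTI; apply: measurable_fst => //.
by apply/seteqP; split => p /=; rewrite in_itv/= andbT.
Qed.

Lemma jointly_measurable_time F x : jointly_measurable F ->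
  measurable_fun (`]0, +oo[%classic : set R) (fun t => F t x).
Proof.
move=> mF; pose p (t : R) : R * BE := (t, x).
apply: (@measurable_comp _ _ _ _ _ _ _ (fun q : R * BE => F q.1 q.2) _ p
  measurable_pos_time _ mF).
  by move=> _ [t /pos_if t0 <-].
by apply: measurable_funTS; exact: pair2_measurable.
Qed.

Lemma jointly_measurable_space F t : jointly_measurable F -> 0 < t ->
  borel_fun (F t).
Proof.
move=> mF t0; pose p (y : BE) : R * BE := (t, y).
apply: (@measurable_comp _ _ _ _ _ _ _ (fun q : R * BE => F q.1 q.2) _ p
  measurable_pos_time _ mF).
  by move=> _ [y _ <-].
exact: pair1_measurable.
Qed.

Section dominated.
Variables (F : R -> E -> R) (b : R -> R).
Hypothesis mF : jointly_measurable F.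
Hypothesis Fb : forall t y, 0 < t -> `|F t y| <= b t.
Hypothesis ib : mu.-integrable `]0, +oo[ (EFin \o b).

Let f (p : R * E) : R := if 0 < p.1 then F p.1 p.2 else 0.
Let g (t : R) : R := if 0 < t then b t else 0.

Let mf : @measurable_fun _ _ (measurableTypeR R * BE)%type R setT f.
Proof.
change (@measurable_fun _ _ (R * BE)%type R setT f).
by apply/(@measurable_if _ _ _ [set p : R * BE | 0 < p.1] (fun p => 0 < p.1)
  (fun=> iff_refl _) (fun p => F p.1 p.2) measurable_pos_time).
Qed.

Let fg t y : `|f (t, y)| <= g t * 1.
Proof.
by rewrite mulr1 /f /g/=; case: ifP => t0; [exact: Fb|rewrite normr0].
Qed.

Let ig : mu.-integrable setT (EFin \o g).
Proof. exact/(integrable_if mu pos_if). Qed.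

Let i1 (m : {finite_measure set BE -> \bar R}) :
  m.-integrable setT (EFin \o (fun=> 1 : R)).
Proof. by apply: (@integrable_Bb R E m (fun=> 1)); exact: Bb_cst. Qed.

Let fE y : \int[mu]_(t in `]0, +oo[) F t y = \int[mu]_t f (t, y).
Proof. by rewrite (Rintegral_if mu pos_if). Qed.

Lemma Bb_time_integral : Bb (fun y => \int[mu]_(t in `]0, +oo[) F t y).
Proof.
split.
  rewrite (_ : (fun y => _) = fun y => \int[mu]_t f (t, y)).
    (* Measurability in [y] does not involve a measure on the space, but the Fubini statement asks
       for one; a Dirac mass supplies it. *)
    exact: (measurable_Rintegral2 mf fg ig (i1 (\d_(point : BE)))).
  by apply/funext => y; exact: fE.
exists (\int[mu]_(t in `]0, +oo[) b t) => y.
apply: normr_Rintegral_le ib => //; first exact: jointly_measurable_time.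
by move=> t /pos_if t0; exact: Fb.
Qed.

Let fubini (m : {finite_measure set BE -> \bar R}) :
  mu.-integrable `]0, +oo[ (EFin \o (fun t => \int[m]_y F t y)) /\
  \int[m]_y \int[mu]_(t in `]0, +oo[) F t y =
  \int[mu]_(t in `]0, +oo[) \int[m]_y F t y.
Proof.
have E1 : (fun t => \int[m]_y f (t, y)) =
    fun t => if 0 < t then \int[m]_y F t y else 0.
  apply/funext => t; rewrite /f/=; case: ifP => // _.
  exact: (Rintegral0 m measurableT).
split.
  apply/(integrable_if mu pos_if) => //; rewrite -E1.
  apply: (integrable_le _ _ _ (integrable_mulr (fine (m setT)) _ ig)) => //.
    exact: measurable_Rintegral1 mf fg ig (i1 m).
  move=> t _; rewrite -Rintegral_cst//.
  apply: normr_Rintegral_le => //.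
  - exact: measurable_fun_pair2 mf.
  - by move=> y _; rewrite -[leRHS]mulr1; exact: fg.
  - by apply: (@integrable_Bb R E m (fun=> g t)); exact: Bb_cst.
rewrite (Rintegral_if mu pos_if) -E1.
rewrite (Rintegral_fubini mf fg ig (i1 m)).
by apply: eq_Rintegral => y _; rewrite fE.
Qed.

(** Fubini for each of the two finite measures that represent [K] at [x]. *)
Lemma kernel_op_time_integral K x : kernel_op K ->
  mu.-integrable `]0, +oo[ (EFin \o (fun t => K (F t) x)) /\
  K (fun y => \int[mu]_(t in `]0, +oo[) F t y) x =
  \int[mu]_(t in `]0, +oo[) K (F t) x.
Proof.
move=> /kernel_op_jordan[p [n [_ [_ Kpn]]]].
have BF t : 0 < t -> Bb (F t).
  move=> t0; split; first exact: jointly_measurable_space.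
  by exists (b t) => y; exact: Fb.
have [ip ep] := fubini (p x); have [im en] := fubini (n x).
have KE t : t \in (`]0, +oo[%classic : set R) ->
    K (F t) x = \int[p x]_y F t y - \int[n x]_y F t y.
  by rewrite inE => /pos_if /BF /Kpn ->.
rewrite Kpn; last exact: Bb_time_integral.
rewrite ep en -RintegralB//; split.
  apply: eq_integrable (integrableB _ ip im) => //.
  by move=> t tp; rewrite /= KE.
by apply: eq_Rintegral => t /KE.
Qed.

End dominated.

End time_integrals.

(** * Resolvents and full generators *)

Section kernel_semigroups.
Context (R : realType) (E : ptopologicalType).
Local Notation BE := (@BE E).
Local Notation mu := (@lebesgue_measure R).
Variables (S : R -> @op R E) (M w : R) (hS : kernel_semigroup S M w).
Implicit Types (f g u : E -> R) (K : @op R E) (l t a r : R).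

Let pos_if (t : R) : `]0, +oo[%classic t <-> (0 < t).
Proof. by rewrite /= in_itv/= andbT. Qed.

Let oc_if (s t : R) : `]0, s]%classic t <-> (0 < t <= s).
Proof. by rewrite /= in_itv/=. Qed.

Lemma semigroup_kernel t : 0 < t -> kernel_op (S t).
Proof. exact: hS.1. Qed.

Lemma semigroup_comp t s f : 0 < t -> 0 < s -> Bb f ->
  S (t + s) f = S t (S s f).
Proof. by move=> t0 s0 Bf; apply/funext => x; exact: hS.2.1. Qed.

Lemma semigroup_norm t f r x : 0 < t -> Bb f -> (forall y, `|f y| <= r) ->
  `|S t f x| <= M * r * expR (w * t).
Proof.
by move=> t0 Bf fr; rewrite mulrAC; exact: (hS.2.2.1 t t0 f r Bf fr x).
Qed.

Lemma semigroup_jointly_measurable f : Bb f ->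
  jointly_measurable (fun t => S t f).
Proof. exact: hS.2.2.2. Qed.

Lemma semigroup_Bb t f : 0 < t -> Bb f -> Bb (S t f).
Proof.
move=> t0 Bf; split.
  exact: (jointly_measurable_space (semigroup_jointly_measurable Bf)).
by have [_ [r fr]] := Bf; exists (M * r * expR (w * t)) => x;
  exact: semigroup_norm.
Qed.

Lemma semigroup_exp_bounded f r x : Bb f -> (forall y, `|f y| <= r) ->
  exp_bounded (fun t => S t f x) (M * r) w.
Proof.
move=> Bf fr; split; last by move=> t t0; exact: semigroup_norm.
exact: jointly_measurable_time (semigroup_jointly_measurable Bf).
Qed.

Lemma semigroup_const_ge0 : 0 <= M.
Proof.
have := @semigroup_exp_bounded (fun=> 1) 1 point (Bb_cst E 1).
by rewrite normr1 mulr1 => /(_ (fun=> lexx _)) /exp_bounded_ge0.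
Qed.

Lemma laplaceE l f x :
  laplace S l f x = \int[mu]_(t in `]0, +oo[) (expR (- (l * t)) * S t f x).
Proof. by []. Qed.

Lemma laplace_norm l f r x : w < l -> Bb f -> (forall y, `|f y| <= r) ->
  `|laplace S l f x| <= M * r / (l - w).
Proof.
move=> wl Bf fr; rewrite laplaceE.
exact: exp_bounded_norm (semigroup_exp_bounded x Bf fr) wl.
Qed.

Lemma laplace_integrable l f x : w < l -> Bb f ->
  mu.-integrable `]0, +oo[ (EFin \o (fun t => expR (- (l * t)) * S t f x)).
Proof.
move=> wl Bf; have [_ [r fr]] := Bf.
exact: exp_bounded_integrable (semigroup_exp_bounded x Bf fr) wl.
Qed.

Lemma laplace_lin l a f g : w < l -> Bb f -> Bb g ->
  laplace S l (fun x => a * f x + g x) =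
  (fun x => a * laplace S l f x + laplace S l g x).
Proof.
move=> wl Bf Bg; apply/funext => x; rewrite !laplaceE.
rewrite -RintegralZl ?laplace_integrable// -RintegralD ?laplace_integrable//.
  apply: eq_Rintegral => t; rewrite inE => /pos_if t0.
  by rewrite kernel_op_lin//; [lra|exact: semigroup_kernel].
by apply: integrable_mull => //; exact: laplace_integrable.
Qed.

Lemma laplace_scale l a f : w < l -> Bb f ->
  laplace S l (fun x => a * f x) = (fun x => a * laplace S l f x).
Proof.
move=> wl Bf; apply/funext => x; rewrite !laplaceE.
rewrite -RintegralZl ?laplace_integrable//; apply: eq_Rintegral => t.
rewrite inE => /pos_if t0.
by rewrite kernel_op_scale//; [lra|exact: semigroup_kernel].
Qed.

Section laplace_dominated.
Variables (l r : R) (f : E -> R).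
Hypotheses (wl : w < l) (Bf : Bb f) (fr : forall y, `|f y| <= r).

Let F (t : R) (x : E) : R := expR (- (l * t)) * S t f x.
Let b (t : R) : R := M * r * expR (- ((l - w) * t)).

Let mF : jointly_measurable F.
Proof.
apply: measurable_funM; last exact: semigroup_jointly_measurable.
apply: measurable_funTS; apply: measurableT_comp => //.
by apply: measurableT_comp => //; exact: measurable_funM.
Qed.

Let Fb t y : 0 < t -> `|F t y| <= b t.
Proof.
move=> t0; rewrite /F /b normrM (ger0_norm (expR_ge0 _)).
apply: (le_trans (ler_wpM2l (expR_ge0 _) (semigroup_norm y t0 Bf fr))).
rewrite mulrCA -expRD le_eqVlt; apply/orP; left; apply/eqP.
by congr (_ * expR _); lra.
Qed.

Let ib : mu.-integrable `]0, +oo[ (EFin \o b).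
Proof. by apply: integrable_mull => //; apply: integrable_expRN;
  rewrite subr_gt0. Qed.

Lemma laplace_Bb_dominated : Bb (laplace S l f).
Proof. exact: Bb_time_integral mF Fb ib. Qed.

Lemma kernel_op_laplace_dominated K x : kernel_op K ->
  mu.-integrable `]0, +oo[ (EFin \o (fun t =>
    expR (- (l * t)) * K (S t f) x)) /\
  K (laplace S l f) x =
  \int[mu]_(t in `]0, +oo[) (expR (- (l * t)) * K (S t f) x).
Proof.
move=> kK; have [iK eK] := kernel_op_time_integral mF Fb ib x kK.
have KE t : t \in (`]0, +oo[%classic : set R) ->
    K (F t) x = expR (- (l * t)) * K (S t f) x.
  rewrite inE => /pos_if t0.
  by rewrite /F kernel_op_scale//; exact: semigroup_Bb.
split.
  by apply: eq_integrable iK => // t /KE /= ->.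
by rewrite [LHS]eK; apply: eq_Rintegral => t /KE.
Qed.

End laplace_dominated.

Lemma laplace_Bb l f : w < l -> Bb f -> Bb (laplace S l f).
Proof. by move=> wl Bf; have [_ [r fr]] := Bf;
  exact: laplace_Bb_dominated fr. Qed.

Lemma kernel_op_laplace l f K x : w < l -> Bb f -> kernel_op K ->
  mu.-integrable `]0, +oo[ (EFin \o (fun t =>
    expR (- (l * t)) * K (S t f) x)) /\
  K (laplace S l f) x =
  \int[mu]_(t in `]0, +oo[) (expR (- (l * t)) * K (S t f) x).
Proof.
by move=> wl Bf kK; have [_ [r fr]] := Bf;
  exact: (kernel_op_laplace_dominated wl Bf fr).
Qed.

Lemma semigroup_integrable_oc t f x : Bb f ->
  mu.-integrable `]0, t] (EFin \o (fun s => S s f x)).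
Proof.
move=> Bf; have [_ [r fr]] := Bf.
exact: exp_bounded_integrable_oc (semigroup_exp_bounded x Bf fr).
Qed.

Lemma full_generatorP u g : full_generator S (u, g) <->
  [/\ Bb u, Bb g & forall t, 0 < t -> forall x,
    S t u x = u x + \int[mu]_(s in `]0, t]) S s g x].
Proof.
split=> [[Bu [Bg ug]]|[Bu Bg ug]].
  by split=> // t t0 x; rewrite /Rintegral ug//= addrC subrK.
split=> //; split=> // t t0 x; rewrite ug// addrC addKr /Rintegral fineK//.
by apply: integrable_fin_num => //; exact: semigroup_integrable_oc.
Qed.

(** The primitive of [s |-> S s g x] is [S t u x - u x], so [laplace_primitive] reads
    [R(l) g = l R(l) u - u]. *)
Lemma laplace_full_generator l u g : w < l -> 0 < l ->
  full_generator S (u, g) ->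
  laplace S l (fun x => l * u x - g x) = u.
Proof.
move=> wl l0 /full_generatorP[Bu Bg ug]; apply/funext => x.
rewrite (_ : (fun x => _) = fun x => l * u x + (-1) * g x); last first.
  by apply/funext => y; rewrite mulN1r.
rewrite laplace_lin//; last exact: Bb_scale.
rewrite laplace_scale// mulN1r.
have [_ [r gr]] := Bg.
have gb := semigroup_exp_bounded x Bg gr.
have iu := laplace_integrable x wl Bu.
have ie : mu.-integrable `]0, +oo[ (EFin \o (fun t =>
  l * u x * expR (- (l * t)))).
  by apply: integrable_mull => //; exact: integrable_expRN.
have prim : \int[mu]_(t in `]0, +oo[) (expR (- (l * t)) * S t g x) =
    \int[mu]_(t in `]0, +oo[) (l * (expR (- (l * t)) * S t u x)) -
    \int[mu]_(t in `]0, +oo[) (l * u x * expR (- (l * t))).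
  rewrite -(laplace_primitive gb wl l0) -RintegralB//;
    last exact: integrable_mull.
  apply: eq_Rintegral => t; rewrite inE => /pos_if t0.
  by rewrite (ug t t0 x); lra.
rewrite !laplaceE prim -RintegralZl// opprB addrC subrK.
rewrite RintegralZl//; last exact: integrable_expRN.
by rewrite Rintegral_expRN// mulr0 oppr0 expR0 div1r mulrAC divff ?mul1r//
  gt_eqF.
Qed.

(** [S t] enters the Laplace integral and shifts the time by [t]: what remains is the tail of the
    integral, rescaled. *)
Lemma semigroup_laplace l t f x : w < l -> 0 < t -> Bb f ->
  S t (laplace S l f) x =
  expR (l * t) * \int[mu]_(r in `]t, +oo[) (expR (- (l * r)) * S r f x).
Proof.
move=> wl t0 Bf; have [_ ->] := kernel_op_laplace x wl Bf (semigroup_kernel t0).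
have [ih sh] := Rintegral_shift (ltW t0) (laplace_integrable x wl Bf).
rewrite -sh -RintegralZl//; apply: eq_Rintegral => s; rewrite inE => /pos_if s0.
rewrite -semigroup_comp// mulrA -expRD addrC.
by congr (expR _ * _); lra.
Qed.

(** By [semigroup_laplace] the orbit of [R(l) f] is a rescaled tail of the Laplace integral, so
    [resolvent_primitive] is exactly the required equation. *)
Lemma full_generator_laplace l f : w < l -> 0 < l -> Bb f ->
  full_generator S (laplace S l f, fun x => l * laplace S l f x - f x).
Proof.
move=> wl l0 Bf; have BL := laplace_Bb wl Bf.
have Bg : Bb (fun x => l * laplace S l f x - f x).
  rewrite (_ : (fun x => _) = fun x => -1 * f x + l * laplace S l f x).
    by apply: Bb_lin => //; exact: Bb_scale.
  by apply/funext => x; rewrite mulN1r addrC.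
apply/full_generatorP; split => // t t0 x.
have [_ [r fr]] := Bf.
have fb := semigroup_exp_bounded x Bf fr.
have ifx := semigroup_integrable_oc t x Bf.
have iLx := semigroup_integrable_oc t x BL.
have res := resolvent_primitive fb wl l0 t0.
rewrite (_ : \int[mu]_(s in `]0, t]) S s _ x =
    \int[mu]_(s in `]0, t]) (l * expR (l * s) *
      \int[mu]_(r in `]s, +oo[) (expR (- (l * r)) * S r f x)) -
    \int[mu]_(s in `]0, t]) S s f x).
  by rewrite semigroup_laplace// res laplaceE; lra.
transitivity (\int[mu]_(s in `]0, t]) (l * S s (laplace S l f) x - S s f x)).
  apply: eq_Rintegral => s; rewrite inE => /oc_if/andP[s0 _].
  rewrite (_ : (fun x => _) = fun x => -1 * f x + l * laplace S l f x).
    rewrite kernel_op_lin//; [|exact: semigroup_kernel|exact: Bb_scale].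
    by rewrite kernel_op_scale//; [lra|exact: semigroup_kernel].
  by apply/funext => y; rewrite mulN1r addrC.
rewrite RintegralB//; last exact: integrable_mull.
congr (_ - _); apply: eq_Rintegral => s; rewrite inE => /oc_if/andP[s0 _].
by rewrite semigroup_laplace// mulrA.
Qed.

Lemma semigroup_laplace_comm l t f : w < l -> 0 < t -> Bb f ->
  S t (laplace S l f) = laplace S l (S t f).
Proof.
move=> wl t0 Bf; apply/funext => x.
have [_ ->] := kernel_op_laplace x wl Bf (semigroup_kernel t0).
rewrite laplaceE; apply: eq_Rintegral => s; rewrite inE => /pos_if s0.
by rewrite -!semigroup_comp// addrC.
Qed.

(** Each [S t] is bp-continuous, and the time integrals converge by domination on bounded intervals.
    Applied to [S], this makes the perturbed relation bp-closed. *)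
Lemma full_generator_bp_closed : bp_closed (full_generator S).
Proof.
move=> s [u g] Ss [[C sC] [su sg]] /=.
have Bu n : Bb (s n).1 by have := Ss n;
  rewrite (surjective_pairing (s n)) => /full_generatorP[].
have Bg n : Bb (s n).2 by have := Ss n;
  rewrite (surjective_pairing (s n)) => /full_generatorP[].
have uC n x : `|(s n).1 x| <= C by have [] := sC n x.
have gC n x : `|(s n).2 x| <= C by have [] := sC n x.
have Blu := Bb_cvg Bu uC su; have Blg := Bb_cvg Bg gC sg.
apply/full_generatorP; split => // t t0 x.
rewrite /= in su sg Blu Blg.
have c1 := kernel_op_cvg (semigroup_kernel t0) Bu uC su x.
have c2 : \int[mu]_(r in `]0, t]) S r (s n).2 x @[n --> \oo] -->
    \int[mu]_(r in `]0, t]) S r g x.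
  have ib : mu.-integrable `]0, t] (EFin \o (fun r => M * C * expR (w * r))).
    apply: integrable_mull => //; exact: integrable_expR_oc.
  apply: (Rintegral_dominated_cvg _ _ _ ib) => //.
  - move=> n; apply/measurable_EFinP.
    exact: measurable_int (semigroup_integrable_oc t x (Bg n)).
  - move=> r /oc_if/andP[r0 _].
    exact: kernel_op_cvg (semigroup_kernel r0) Bg gC sg x.
  - by move=> n r /oc_if/andP[r0 _]; apply: semigroup_norm.
have c3 := cvgD (su x) c2.
have e : (fun n => S t (s n).1 x) =
    (fun n => (s n).1 x + \int[mu]_(r in `]0, t]) S r (s n).2 x).
  apply/funext => n; have := Ss n; rewrite (surjective_pairing (s n)).
  by move=> /full_generatorP[_ _ ->].
by rewrite e in c1; exact: (cvg_unique _ c1 (c3 _)).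
Qed.

End kernel_semigroups.

(** * Transport of bp-cores *)

Section bp_core.
Context (R : realType) (E : ptopologicalType).
Implicit Types (A D : set ((E -> R) * (E -> R))) (B : @op R E).

Lemma rel_add_in A B u f : A (u, f) -> rel_add A B (u, f \+ B u).
Proof. by move=> Auf; exists u, f. Qed.

(* [B] is not bp-continuous on its domain, but on the graph of the generator
   [B u = B R(l) (l u - f)], and [B R(l)] is a kernel operator. *)
Lemma bp_core_perturbation (T : R -> @op R E) (M w l : R) B D :
  kernel_semigroup T M w -> w < l -> 0 < l ->
  kernel_op (fun f => B (laplace T l f)) ->
  bp_closed (rel_add (full_generator T) B) ->
  bp_core (full_generator T) D ->
  bp_core (rel_add (full_generator T) B) (rel_add D B).
Proof.
move=> hT wl l0 kB cAB [DA Dcl].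
have sub : rel_add D B `<=` rel_add (full_generator T) B.
  by move=> _ [u [f [Duf ->]]]; apply: rel_add_in; exact: DA.
split => //; apply/seteqP; split; first by move=> p; apply.
move=> _ [u [f [Auf ->]]] X DX cX.
(* Intersecting with the generator keeps the formula [B u = B R(l) (l u - f)] available for every
   member of [Y]. *)
pose Y : set ((E -> R) * (E ->
  R)) := full_generator T `&` [set p | X (p.1, p.2 \+ B p.1)].
suff : Y (u, f) by case.
rewrite -Dcl in Auf; apply: Auf.
  by move=> [v g] Dvg; split; [exact: DA|apply: DX; exact: rel_add_in].
move=> s p Ys sp.
have Ap : full_generator T p.
  by apply: (full_generator_bp_closed hT _ sp) => n; have [] := Ys n.
split=> //=.
apply: (cX (fun n => ((s n).1, (s n).2 \+ B (s n).1))).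
  by move=> n; have [] := Ys n.
have BE q : full_generator T q ->
  B q.1 = B (laplace T l (fun x => l * q.1 x - q.2 x)).
  by case: q => v g /(laplace_full_generator hT wl l0) ->.
have Bq q : full_generator T q -> Bb (fun x => l * q.1 x - q.2 x).
  case: q => v g /(full_generatorP hT)[Bv Bg _].
  rewrite (_ : (fun x => _) = fun x => -1 * g x + l * v x).
    by apply: Bb_lin => //; exact: Bb_scale.
  by apply/funext => y /=; rewrite mulN1r addrC.
have [[C sC] [s1 s2]] := sp.
have [c c0 Bc] := kernel_op_bounded kB.
pose C' := `|l| * C + C.
have sC' n x : `|l * (s n).1 x - (s n).2 x| <= C'.
  have [b1 b2] := sC n x.
  by rewrite (le_trans (ler_normB _ _))// normrM lerD// ler_wpM2l.
have As n : full_generator T (s n) by have [] := Ys n.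
split; [|split].
- exists (C + c * C') => n x /=; have [b1 b2] := sC n x; split.
    have C'0 : 0 <= C' by rewrite (le_trans _ (sC' n x)).
    by rewrite (le_trans b1)// lerDl mulr_ge0.
  rewrite (le_trans (ler_normD _ _))// lerD// BE//.
  by apply: Bc => //; exact: Bq.
- exact: s1.
- move=> x /=; apply: cvgD; first exact: s2.
  rewrite BE// (_ : (fun n => _) = fun n =>
      B (laplace T l (fun x => l * (s n).1 x - (s n).2 x)) x); last first.
    by apply/funext => n; rewrite BE.
  apply: (kernel_op_cvg kB (fun n => Bq _ (As n)) sC') => y.
  by apply: cvgB; [apply: cvgMl_tmp; exact: s1|exact: s2].
Qed.

End bp_core.

(** * Monotone classes and vanishing at infinity *)

Section metric.
Context (R : realType) (E : ptopologicalType) (d : E -> E -> R).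
Hypotheses (d0 : forall x y, 0 <= d x y) (dxx : forall x, d x x = 0)
  (dC : forall x y, d x y = d y x) (dT : forall x y z, d x z <= d x y + d y z)
  (dopen : forall A : set E, open A <->
    forall x, A x -> exists2 e : R, 0 < e & forall y, d x y < e -> A y).

Lemma open_dball x e : open [set y | d x y < e].
Proof.
apply/dopen => y /= xy; exists (e - d x y); first by rewrite subr_gt0.
by move=> z yz /=; have := dT x y z; lra.
Qed.

Lemma nbhs_dball x (A : set E) : nbhs x A <->
  exists2 e : R, 0 < e & forall y, d x y < e -> A y.
Proof.
split=> [|[e e0 eA]].
  rewrite nbhsE => -[B [oB Bx] BA]; have [e e0 eB] := (dopen B).1 oB x Bx.
  by exists e => // y /eB /BA.
rewrite nbhsE; exists [set y | d x y < e] => //.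
by split; [exact: open_dball|rewrite /= dxx].
Qed.

Lemma lipschitz_continuous (f : E -> R) (c : R) :
  (forall x y, f x - f y <= c * d x y) -> continuous f.
Proof.
move=> fc x; apply/cvgrPdist_lt => e e0.
(* [c] may have any sign, and the added [1] keeps the radius defined when it is zero. *)
have c0 : 0 < `|c| + 1 by rewrite ltr_wpDl.
apply/nbhs_dball; exists (e / (`|c| + 1)); first by rewrite divr_gt0.
move=> y; rewrite ltr_pdivlMr// => xy.
have cd : c * d x y <= d x y * (`|c| + 1).
  by rewrite mulrC ler_wpM2l// (le_trans (ler_norm c))// lerDl.
rewrite ltr_norml; apply/andP; split; last by have := fc x y; lra.
by have := fc y x; rewrite dC; lra.
Qed.

Definition dist (A : set E) (x : E) : R := inf [set d x a | a in A].

Section dist.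
Variables (A : set E) (A0 : A !=set0).

Let has_lb x : has_lbound [set d x a | a in A].
Proof. by exists 0 => _ [a _ <-]. Qed.

Let nonempty x : [set d x a | a in A] !=set0.
Proof. by have [a Aa] := A0; exists (d x a), a. Qed.

Lemma dist_ge0 x : 0 <= dist A x.
Proof. by apply: lb_le_inf => // _ [a _ <-]. Qed.

Lemma dist_le x a : A a -> dist A x <= d x a.
Proof. by move=> Aa; apply: ge_inf => //; exists a. Qed.

Lemma dist_in x : A x -> dist A x = 0.
Proof.
by move=> Ax; apply/le_anti; rewrite dist_ge0 andbT -(dxx x); exact: dist_le.
Qed.

Lemma dist_lipschitz x y : dist A x - dist A y <= d x y.
Proof.
rewrite lerBlDr -lerBlDl; apply: lb_le_inf => // _ [a Aa <-].
by rewrite lerBlDl; apply: (le_trans (dist_le x Aa)).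
Qed.

Lemma continuous_dist : continuous (dist A).
Proof.
by apply: (@lipschitz_continuous _ 1) => x y; rewrite mul1r dist_lipschitz.
Qed.

Lemma dist_gt0 x : open (~` A) -> ~ A x -> 0 < dist A x.
Proof.
move=> /dopen /(_ x) /[apply] -[e e0 eA]; apply: (lt_le_trans e0).
apply: lb_le_inf => // _ [a Aa <-]; rewrite leNgt; apply/negP => /eA.
exact.
Qed.

End dist.

(* [min 1 (n dist(x, ~U))] increases to the indicator of the open set [U]. *)
Definition bump (U : set E) (n : nat) (x : E) : R :=
  if `[< U = setT >] then 1 else Num.min 1 (n%:R * dist (~` U) x).

Section bump.
Variables (U : set E) (oU : open U).

(** The infimum over an empty complement would be [0] rather than infinity, hence the separate case
    of [bump] for [U = setT]. *)
Let U0 : U <> setT -> ~` U !=set0.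
Proof. by move=> UT; apply/set0P/eqP => U0; apply: UT;
  rewrite -[U]setCK U0 setC0. Qed.

Lemma bump_ge0 n x : 0 <= bump U n x.
Proof.
rewrite /bump; case: asboolP => // UT; rewrite le_min ler01/= mulr_ge0//.
exact: dist_ge0 (U0 UT) x.
Qed.

Lemma bump_le1 n x : bump U n x <= 1.
Proof. by rewrite /bump; case: asboolP => // UT; rewrite ge_min lexx. Qed.

Lemma bump_out n x : ~ U x -> bump U n x = 0.
Proof.
move=> Ux; rewrite /bump; case: asboolP => [UT|UT]; first by case: Ux;
  rewrite UT.
by rewrite dist_in ?mulr0 ?min_r//; exact: U0.
Qed.

Lemma continuous_bump n : continuous (bump U n).
Proof.
rewrite /bump; case: asboolP => [UT|UT]; first by move=> x; exact: cvg_cst.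
apply: (@lipschitz_continuous _ n%:R) => x y.
have h1 := ler_wpM2l (ler0n R n) (dist_lipschitz (U0 UT) x y).
have h2 : 0 <= n%:R * d x y by rewrite mulr_ge0.
by case: (lerP 1 (n%:R * dist _ x)); case: (lerP 1 (n%:R * dist _ y)); lra.
Qed.

Lemma bump_eq1 n x : (n%:R * dist (~` U) x >= 1) -> bump U n x = 1.
Proof. by move=> h; rewrite /bump; case: asboolP => // _; rewrite min_l. Qed.

Lemma bump_eventually x : U x -> \forall n \near \oo, bump U n x = 1.
Proof.
move=> Ux; rewrite /bump; case: asboolP => [UT|UT]; first exact: nearW.
have dx : 0 < dist (~` U) x.
  by apply: dist_gt0; [exact: U0|rewrite setCK|apply].
near=> n; rewrite min_l// -ler_pdivrMr//.
near: n; exact: nbhs_infty_ger.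
Unshelve. all: by end_near. Qed.

Lemma cvg_bump x : bump U n x @[n --> \oo] --> (\1_U x : R).
Proof.
have [Ux|Ux] := pselect (U x).
  rewrite indicE mem_set//; apply: cvg_near_cst; exact: bump_eventually.
rewrite indicE memNset//; apply: cvg_near_cst; apply: nearW => n.
exact: bump_out.
Qed.

End bump.

End metric.

Section functional_monotone_class.
Context (R : realType) (E : ptopologicalType).
Hypothesis polE : @polish_space R E.
Local Notation BE := (@BE E).
Implicit Types f g : E -> R.

Lemma Cb_Bb f : Cb f -> Bb f.
Proof.
move=> [/continuousP cf bf]; split => //.
apply: (measurability _ (RGenOpens.measurableE R)).
move=> _ [_ [a [b ->] <-]]; rewrite setTI; apply: sub_sigma_algebra.
by apply: cf; exact: interval_open.
Qed.

Lemma Bb_indic (A : set BE) : measurable A -> Bb (\1_A : E -> R).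
Proof.
move=> mA; split; first exact: (@measurable_indic _ BE R setT).
by exists 1 => x; rewrite indicE ger0_norm// lern1 leq_b1.
Qed.

Import HBNNSimple.

(** Functional monotone class principle. Indicators of open sets are bp-limits of bumps, and open
    sets are stable under intersection, so Dynkin induction reaches all Borel sets. Simple functions
    increase to a nonnegative function, and adding a bound makes any bounded function
    nonnegative. *)
Lemma Bb_ind (P : (E -> R) -> Prop) :
  (forall f, Cb f -> P f) ->
  (forall a f g, Bb f -> Bb g -> P f -> P g -> P (fun x => a * f x + g x)) ->
  (forall (f_ : nat -> E -> R) f (C : R), (forall n, Bb (f_ n)) ->
    (forall n, P (f_ n)) -> (forall n x, `|f_ n x| <= C) ->
    (forall x, f_ n x @[n --> \oo] --> f x) -> P f) ->
  forall f, Bb f -> P f.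
Proof.
move=> Pcb Plin Pbp.
have Pcst a : P (fun=> a).
  by apply: Pcb; split; [move=> x; exact: cvg_cst|exists `|a|].
have Pind (A : set BE) : measurable A -> P (\1_A).
  have [_ [d [d0 [dE [dC [dT [dopen _]]]]]]] := polE.
  have dxx x : d x x = 0 by apply/dE.
  apply: (@dynkin_induction _ BE (@open E) (fun A => P (\1_A))) => //.
  - exact: openI.
  - by rewrite indicT; exact: Pcst.
  - move=> U oU; have cb n : Cb (bump d U n).
      split; first exact: continuous_bump.
      by exists 1 => x; rewrite ger0_norm ?bump_le1// bump_ge0.
    apply: (Pbp (bump d U) _ 1).
    + by move=> n; exact: Cb_Bb.
    + by move=> n; exact: Pcb.
    + by move=> n x; rewrite ger0_norm ?bump_le1// bump_ge0.
    + by move=> x; exact: cvg_bump.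
  - move=> S mS PS; rewrite (_ : \1_(~` S) = fun x => -1 * \1_S x + 1).
      by apply: Plin => //; [exact: Bb_indic|exact: Bb_cst].
    by apply/funext => x; rewrite !indicE in_setC; case: (x \in S) => /=; lra.
  - move=> F mF tF PF.
    have PU n : P (\1_(\big[setU/set0]_(i < n) F i)).
      elim: n => [|n ih]; first by rewrite big_ord0 indic0; exact: Pcst.
      rewrite big_ord_recr /= (_ : \1_(_ `|` _) =
          fun x => 1 * \1_(\big[setU/set0]_(i < n) F i) x + \1_(F n) x).
        apply: Plin => //; last exact: Bb_indic.
        by apply: Bb_indic; apply: bigsetU_measurable.
      apply/funext => x; rewrite mul1r.
      rewrite !indicE in_setU; case: (boolP (x \in F n)) => [xn|]; last first.
        by rewrite orbF addr0.
      rewrite orbT (_ : (x \in _) = false) ?add0r//.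
      apply/negbTE/negP; rewrite -bigcup_mkord inE => -[i /= ltin Fix].
      suff /eqP : i = n by rewrite lt_eqF.
      by apply: tF => //; exists x; split => //; rewrite -inE.
    apply: (Pbp (fun n => \1_(\big[setU/set0]_(i < n) F i)) _ 1) => //.
    + by move=> n; apply: Bb_indic; exact: bigsetU_measurable.
    + by move=> n x; rewrite indicE ger0_norm// lern1 leq_b1.
    + move=> x; have [[i _ Fix]|nFx] := pselect ((\bigcup_k F k) x); last first.
        rewrite indicE memNset//; apply: cvg_near_cst; apply: nearW => n.
        rewrite indicE memNset// -bigcup_mkord => -[i _ Fix].
        by apply: nFx; exists i.
      rewrite indicE mem_set; last by exists i.
      apply: cvg_near_cst; exists i.+1 => // n /= ltin.
      by rewrite indicE mem_set// -bigcup_mkord; exists i.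
have Pnn (f : E -> R) : Bb f -> (forall x, 0 <= f x) -> P f.
  move=> [mf [C fC]] f0.
  have mfE : measurable_fun setT (EFin \o (f : BE ->
    R)) by exact/measurable_EFinP.
  pose g := nnsfun_approx measurableT mfE.
  have gf x : (g n x : R) @[n --> \oo] --> f x.
    have := @cvg_nnsfun_approx _ _ _ _ measurableT _ mfE _ x I.
    by move=> /(_ (fun x _ => f0 x)) /fine_cvg.
  have gle n x : g n x <= f x.
    rewrite -(cvg_lim _ (gf x))//; apply: nondecreasing_cvgn_le.
      by move=> m k mk; exact/lefP/nd_nnsfun_approx.
    by apply: cvgP (gf x).
  apply: (Pbp (fun n => g n) _ C) => //.
  - move=> n; split; first exact: measurable_funP.
    by exists C => x; rewrite ger0_norm// (le_trans (gle n x))//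
      (le_trans (ler_norm _)).
  - move=> n.
    have mg (y : R) : measurable (g n @^-1` [set y]) by exact:
      measurable_funPTI.
    (* Stated for an arbitrary list of values, so that the induction is not tied to the range of
       [g n]. *)
    have gE (s : seq R) :
        Bb (fun x : E => \sum_(y <- s) (y * \1_(g n @^-1` [set y]) x)) /\
        P (fun x => \sum_(y <- s) (y * \1_(g n @^-1` [set y]) x)).
      elim: s => [|y s [ihB ihP]].
        rewrite (_ : (fun x => _) = fun=> 0); first by split; [exact: Bb_cst|].
        by apply/funext => x; rewrite big_nil.
      rewrite (_ : (fun x => _) = fun x => y * \1_(g n @^-1` [set y]) x +
          \sum_(z <- s) (z * \1_(g n @^-1` [set z]) x)).
        split; first by apply: Bb_lin => //; exact: Bb_indic.
        by apply: Plin => //; [exact: Bb_indic|exact: Pind].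
      by apply/funext => x; rewrite big_cons.
    have [s gs] : exists s : seq R, forall x,
        g n x = \sum_(y <- s) (y * \1_(g n @^-1` [set y]) x).
      by eexists => x; rewrite [LHS]fimfunE fsbig_finite.
    rewrite (_ : HBNNSimple.NonNegSimpleFun.sort (g n) = fun x : E =>
        \sum_(y <- s) y * \1_(g n @^-1` [set y]) x); first exact: (gE s).2.
    by apply: funext => x; exact: gs.
  - by move=> n x; rewrite ger0_norm// (le_trans (gle n x))//
    (le_trans (ler_norm _)).
move=> f Bf; have [mf [C fC]] := Bf.
rewrite (_ : f = fun x => 1 * (f x + C) + - C); last first.
  by apply/funext => x; lra.
have BfC : Bb (fun x => f x + C).
  rewrite (_ : (fun x => _) = fun x => 1 * f x + C).
    by apply: Bb_lin => //; exact: Bb_cst.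
  by apply/funext => x; rewrite mul1r.
apply: Plin => //; first exact: Bb_cst.
by apply: Pnn => // x; have := fC x; rewrite ler_norml => /andP[]; lra.
Qed.

End functional_monotone_class.

(** * Compact exhaustion and escaping sequences *)

Section exhaustion.
Context (R : realType) (E : ptopologicalType).
Hypotheses (lcE : @locally_compact_space E) (polE : @polish_space R E).

Lemma compact_in_increasing (U : nat -> set E) (K : set E) :
  (forall n, open (U n)) -> (forall m n, (m <= n)%N -> U m `<=` U n) ->
  compact K -> (forall x, K x -> exists n, U n x) -> exists n, K `<=` U n.
Proof.
move=> oU mU; rewrite compact_cover => /(_ nat setT U (fun n _ => oU n)) cK KU.
have [|D _ KD] := cK; first by move=> x /KU[n Unx]; exists n.
exists (\max_(i <- D) i)%N => x /KD[i /= iD Uix].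
by apply: mU Uix; apply: leq_bigmax_seq.
Qed.

(** Separability cuts local compactness down to countably many choices: for each point of a dense
    sequence and each radius [1 / (m + 1)], one compact set containing that ball if there is any.
    Finite unions of the chosen sets exhaust the space. *)
Lemma compact_exhaustion : exists K : nat -> set E,
  [/\ forall n, compact (K n),
      forall m n, (m <= n)%N -> K m `<=` K n &
      forall C, compact C -> exists n, C `<=` (K n)^°].
Proof.
have [[D [/countable_injP[f finj] Ddense]] [d [d0 [dE [dC [dT [dopen _]]]]]]]
  := polE.
have dxx x : d x x = 0 by apply/dE.
pose eps (m : nat) : R := m.+1%:R^-1.
(* [n] numbers a point of [D] through the injection [f]; the condition on the ball is empty when no
   point has that number. *)
pose good n m (V : set E) := compact V /\
  forall q, D q -> f q = n -> forall y, d q y < eps m -> V y.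
have /choice[V VP] nm : exists V, compact V /\
    ((exists W, good nm.1 nm.2 W) -> good nm.1 nm.2 V).
  have [[W gW]|nW] := pselect (exists W, good nm.1 nm.2 W).
    by exists W; split => //; case: gW.
  by exists set0; split => //; exact: compact0.
pose K N := \big[setU/set0]_(nm <- [seq (n, m) | n <- iota 0 N,
  m <- iota 0 N]) V nm.
have KE N x : K N x <-> exists n m, [/\ (n < N)%N, (m < N)%N & V (n, m) x].
  rewrite /K -bigcup_seq; split.
    move=> [[n m] /= /allpairsP[[a b] /= [aN bN [-> ->]]] Vx].
    by exists a, b; rewrite !mem_iota in aN bN.
  move=> [n [m [nN mN Vx]]]; exists (n, m) => //=.
  by apply/allpairsP; exists (n, m); rewrite !mem_iota.
have Kmono m n : (m <= n)%N -> K m `<=` K n.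
  move=> mn x /KE[a [b [am bm Vx]]]; apply/KE; exists a, b.
  by rewrite (leq_trans am mn) (leq_trans bm mn).
exists K; split=> //.
  by move=> n; apply: bigsetU_compact => nm _; have [] := VP nm.
move=> C cC; apply: (@compact_in_increasing (fun n => (K n)^°)) => //.
- by move=> n; exact: open_interior.
- by move=> m n mn; apply: interiorS; exact: Kmono.
move=> x Cx; have [W] := lcE (x := x) I.
move=> nW [cW _].
have {}nW : nbhs x W by move: nW; rewrite /within /=; apply: filterS => y;
  apply.
(* [W] contains the ball of radius [e] at [x]. If [eps m < e / 2] and [q] is within [eps m] of [x],
   the ball of radius [eps m] at [q] still lies in [W] and contains [x]. *)
have [e e0 eW] := (nbhs_dball dxx dT dopen x W).1 nW.
pose m := Num.truncn (2 / e).
have me : eps m < e / 2.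
  rewrite /eps -[ltRHS]invrK ltf_pV2 ?posrE ?invr_gt0 ?divr_gt0// invf_div.
  exact: truncnS_gt.
have m0 : 0 < eps m by rewrite /eps invr_gt0.
have : closure D x by rewrite Ddense.
move=> /(_ [set y | d x y < eps m]) [|q [Dq /= xq]].
  by apply/(nbhs_dball dxx dT dopen); exists (eps m).
have gW : good (f q) m W.
  split => // q' Dq' fq' y q'y; have qq' : q' = q by apply: finj; rewrite ?inE.
  by apply: eW; rewrite qq' in q'y; have := dT x q y; lra.
have [_ VW] := (VP (f q, m)).2 (ex_intro _ W gW).
exists (maxn (f q) m).+1; apply/(nbhs_dball dxx dT dopen).
exists (eps m - d x q); first by rewrite subr_gt0.
move=> y xy; apply/KE; exists (f q), m.
rewrite !ltnS leq_maxl leq_maxr; split => //; apply: (VW q) => //.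
by have := dT q x y; rewrite (dC q x); lra.
Qed.

(** In terms of sequences leaving every compact set, vanishing at infinity passes through integrals
    by dominated convergence. For the converse, a bad point is picked off each member of the
    exhaustion. *)
Lemma vanishes_at_infinity_seqP (f : E -> R) : vanishes_at_infinity f <->
  forall x_ : nat -> E,
    (forall K, compact K -> \forall n \near \oo, ~ K (x_ n)) ->
    f (x_ n) @[n --> \oo] --> (0 : R).
Proof.
split=> [vf x_ x_oo|sf].
  apply/cvgrPdist_le => e e0; have [K [cK fK]] := vf e e0.
  near=> n; rewrite sub0r normrN; apply: fK.
  by near: n; exact: x_oo.
move=> e e0; apply: contrapT => nK.
have [K [cK mK exK]] := compact_exhaustion.
have /choice[x_ x_P] n : exists x, ~ K n x /\ e < `|f x|.
  apply: contrapT => nx; apply: nK; exists (K n); split => // x nKx.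
  by rewrite leNgt; apply/negP => ex; apply: nx; exists x.
have : f (x_ n) @[n --> \oo] --> (0 : R).
  apply: sf => C /exK[N CN]; exists N => // n /= Nn Cx.
  have [+ _] := x_P n; apply; apply: mK Nn _ _.
  exact: interior_subset (CN _ Cx).
move=> /cvgrPdist_lt /(_ e e0) [N _ /(_ N (leqnn N))].
by rewrite sub0r normrN => /lt_trans /(_ (x_P N).2); rewrite ltxx.
Unshelve. all: by end_near. Qed.

(** [K] lies in the interior [U] of some compact set. A bump of [U] vanishes off that set, and
    equals [1] on [K] for large [n] by compactness. *)
Lemma compact_Cinf_majorant (K : set E) : compact K ->
  exists h : E -> R, [/\ Cinf h, forall x, 0 <= h x <= 1 & forall x, K x ->
    h x = 1].
Proof.
move=> cK; have [_ [d [d0 [dE [dC [dT [dopen _]]]]]]] := polE.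
have dxx x : d x x = 0 by apply/dE.
have [L [cL _ exL]] := compact_exhaustion.
have [N KN] := exL K cK; pose U := (L N)^°.
have oU : open U by exact: open_interior.
have b0 n x : 0 <= bump d U n x <= 1 by rewrite bump_ge0//= bump_le1.
have bumpn n : Cinf (bump d U n).
  split; first exact: continuous_bump.
  move=> e e0; exists (L N); split => // x Lx; rewrite bump_out ?normr0 ?ltW//.
  by move=> /interior_subset.
suff [n Kn] : exists n, forall x, K x ->
  bump d U n x = 1 by exists (bump d U n).
have [UT|UT] := pselect (U = setT).
  by exists 0 => x _; rewrite /bump; case: asboolP.
have U0 : ~` U !=set0.
  by apply/set0P/eqP => U0; apply: UT; rewrite -[U]setCK U0 setC0.
pose V n := [set x | 1 < n%:R * dist d (~` U) x].
have oV n : open (V n).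
  have cf : continuous (fun x => n%:R * dist d (~` U) x).
    by move=> x; apply: cvgMl_tmp; exact: continuous_dist.
  by move/continuousP : cf => /(_ _ (@open_gt R 1)).
have mV m n : (m <= n)%N -> V m `<=` V n.
  move=> mn x /= /lt_le_trans; apply.
  by rewrite ler_wpM2r ?ler_nat// dist_ge0.
have [x Kx|n Kn] := compact_in_increasing oV mV cK; last first.
  by exists n => x /Kn /ltW; exact: bump_eq1.
have dx : 0 < dist d (~` U) x.
  by apply: dist_gt0 => //; [rewrite setCK|apply; exact: KN].
exists (Num.truncn (1 / dist d (~` U) x)).+1 => /=.
by rewrite /V /= -ltr_pdivrMr// truncnS_gt.
Qed.

End exhaustion.

(** * Concentrating weights *)

Section concentration.
Context (R : realType).
Local Notation mu := (@lebesgue_measure R).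
Implicit Types (h rho : R -> R) (l w C d eta t : R).

Let pos_if (t : R) : `]0, +oo[%classic t <-> (0 < t).
Proof. by rewrite /= in_itv/= andbT. Qed.

Lemma Rintegral_subset (f : R -> R) (A B : set R) :
  measurable (A : set (measurableTypeR R)) ->
  measurable (B : set (measurableTypeR R)) -> A `<=` B ->
  (forall t, B t -> 0 <= f t) -> mu.-integrable B (EFin \o f) ->
  \int[mu]_(t in A) f t <= \int[mu]_(t in B) f t.
Proof.
move=> mA mB AB f0 iB.
rewrite (Rintegral_if mu (fun t => rwP (asboolP (A t)))).
rewrite (Rintegral_if mu (fun t => rwP (asboolP (B t)))).
apply: le_Rintegral => //.
- apply/(integrable_if mu (fun t => rwP (asboolP (A t)))) => //.
  exact: (integrableS mB mA AB iB).
- exact/(integrable_if mu (fun t => rwP (asboolP (B t)))).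
- move=> t _; case: asboolP => [/AB Bt|_]; first by case: asboolP.
  by case: asboolP => // /f0.
Qed.

(** Weights to which the Laplace method applies: powers of [rho] decay geometrically away from [p],
    while their mass decays more slowly than any geometric rate. The interval in the last clause
    need not contain [p], so [p = 0] is allowed. *)
Definition peaked rho (p : R) : Prop :=
  [/\ measurable_fun (`]0, +oo[%classic : set R) rho,
      forall t, 0 < t -> 0 <= rho t <= 1,
      forall e, 0 < e -> exists2 q, q < 1 &
        forall t, 0 < t -> e <= `|t - p| -> rho t <= q &
      forall q, q < 1 -> exists a b, [/\ 0 <= a, a < b &
        forall t, a < t <= b -> q <= rho t]].

Section peaked.
Variables (rho : R -> R) (p l : R) (rhoP : peaked rho p) (l0 : 0 < l).

Let mrho : measurable_fun (`]0, +oo[%classic : set R) rho.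
Proof. by have [] := rhoP. Qed.

Let rho_ge0 t : 0 < t -> 0 <= rho t.
Proof. by move=> t0; have [_ /(_ t t0)/andP[]] := rhoP. Qed.

Let rho_le1 t : 0 < t -> rho t <= 1.
Proof. by move=> t0; have [_ /(_ t t0)/andP[]] := rhoP. Qed.

Let rhoX_ge0 k t : 0 < t -> 0 <= rho t ^+ k.
Proof. by move=> t0; rewrite exprn_ge0// rho_ge0. Qed.

Let rhoX_le1 k t : 0 < t -> rho t ^+ k <= 1.
Proof. by move=> t0; rewrite exprn_ile1// ?rho_ge0 ?rho_le1. Qed.

Lemma peaked_exp_bounded k h C w : exp_bounded h C w ->
  exp_bounded (fun t => rho t ^+ k * h t) C w.
Proof.
move=> [mh hb]; split; first by apply: measurable_funM => //;
  exact: measurable_funX.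
move=> t t0; rewrite normrM ger0_norm ?rhoX_ge0//.
by rewrite (le_trans _ (hb _ t0))// ler_piMl// rhoX_le1.
Qed.

Lemma exp_bounded_cst (c : R) : exp_bounded (fun=> c) `|c| 0.
Proof.
by split; [exact: measurable_cst|move=> t _; rewrite mul0r expR0 mulr1].
Qed.

Lemma peaked_integrable k : mu.-integrable `]0, +oo[
  (EFin \o (fun t => expR (- (l * t)) * rho t ^+ k)).
Proof.
have := exp_bounded_integrable (peaked_exp_bounded k (exp_bounded_cst 1)) l0.
by under [X in EFin \o X]eq_fun do rewrite mulr1.
Qed.

Lemma peaked_lower_bound q : 0 < q -> q < 1 -> exists2 c, 0 < c & forall k,
  c * q ^+ k <= \int[mu]_(t in `]0, +oo[) (expR (- (l * t)) * rho t ^+ k).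
Proof.
move=> q0 q1; have [_ _ _ /(_ q q1)[a [b [a0 ab rq]]]] := rhoP.
exists (expR (- (l * b)) * (b - a));
  first by rewrite mulr_gt0 ?expR_gt0// subr_gt0.
move=> k.
have ik := peaked_integrable k.
have sub : (`]a, b]%classic : set R) `<=` `]0, +oo[%classic.
  by move=> t /=; rewrite !in_itv/= andbT => /andP[/(le_lt_trans a0)].
have mab : measurable (`]a, b]%classic : set (measurableTypeR R)) by [].
have mpos : measurable (`]0, +oo[%classic : set (measurableTypeR R)) by [].
have ikab := integrableS mpos mab sub ik.
apply: (@le_trans _ _ (\int[mu]_(t
  in `]a, b]) (expR (- (l * t)) * rho t ^+ k))).
  have -> : expR (- (l * b)) * (b - a) * q ^+ k =
      \int[mu]_(t in `]a, b]) (expR (- (l * b)) * q ^+ k).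
    have muab : fine (mu `]a, b]) = b - a by rewrite lebesgue_measure_itv/=
      lte_fin ab.
    by rewrite Rintegral_cst// [fine _]muab; lra.
  apply: le_Rintegral => //.
  - have := exp_bounded_integrable_oc b (exp_bounded_cst (expR (- (l * b)) * q
    ^+ k)).
    apply: integrableS => // t /=; rewrite !in_itv/= => /andP[at_ ->].
    by rewrite (le_lt_trans a0 at_).
  - move=> t /=; rewrite in_itv/= => /andP[at_ tb].
    have t0 : 0 < t by exact: le_lt_trans at_.
    apply: ler_pM; rewrite ?expR_ge0 ?exprn_ge0 ?(ltW q0)//.
      by rewrite ler_expR lerN2; apply: ler_wpM2l => //; exact: ltW.
    by apply: lerXn2r; rewrite ?nnegrE ?(ltW q0) ?rho_ge0// rq// at_ tb.
apply: Rintegral_subset => // t /pos_if t0.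
by rewrite mulr_ge0 ?expR_ge0// rhoX_ge0.
Qed.

(** The rank [k0] is chosen before [h] and [h0] and depends on them through [C] and [w] only. It
    therefore serves all orbits [t |-> S t u x] at once, and the resulting estimates are uniform in
    [x]. *)
Lemma peaked_concentration w C d eta : w < l -> 0 < d -> 0 < eta ->
  exists k0, forall k h (h0 e : R), (k0 <= k)%N -> exp_bounded h C w ->
    `|h0| <= C ->
    0 <= e ->
    (forall t, 0 < t -> `|t - p| < d -> `|h t - h0| <= e) ->
    `|\int[mu]_(t in `]0, +oo[) (expR (- (l * t)) * (rho t ^+ k * h t))
      - h0 * \int[mu]_(t in `]0, +oo[) (expR (- (l * t)) * rho t ^+ k)|
    <= (e + eta) * \int[mu]_(t in `]0, +oo[) (expR (- (l * t)) * rho t ^+ k).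
Proof.
move=> wl d0 eta0; have [_ _ /(_ d d0)[q qlt1 rq] _] := rhoP.
(* Away from [p] the weight is at most [q1 ^+ k], while its total mass is at least [c * q2 ^+ k];
   since [q1 < q2] the former becomes negligible. The [1 / 2] makes both rates positive. *)
pose q1 := Num.max q (1 / 2); pose q2 := (1 + q1) / 2.
have [q10 q1lt q12 q2lt] : [/\ 0 < q1, q1 < 1, q1 < q2 & q2 < 1].
  by rewrite /q2 /q1; case: (lerP q (1 / 2)) => ?; split; lra.
have q20 : 0 < q2 by exact: lt_trans q12.
have q1ge := ltW q10; have q2ge := ltW q20.
have mpos : measurable (`]0, +oo[%classic : set (measurableTypeR R)) by [].
have [c c0 cq] := peaked_lower_bound q20 q2lt.
(* [G] majorises [expR (- (l * t)) * |h t - h0|], which is all that is known away from [p]. *)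
pose G (t : R) : R := C * expR (- ((l - w) * t)) + C * expR (- (l * t)).
have iG : mu.-integrable `]0, +oo[ (EFin \o G).
  have i1 := integrable_mull C mpos (integrable_expRN 0 l0).
  have lw : 0 < l - w by rewrite subr_gt0.
  have i2 := integrable_mull C mpos (integrable_expRN 0 lw).
  by apply: eq_integrable (integrableD mpos i2 i1).
pose I := \int[mu]_(t in `]0, +oo[) G t.
have [k0 k0P] : exists k0, forall k, (k0 <= k)%N ->
  q1 ^+ k * I <= eta * (c * q2 ^+ k).
  have q12ge : 0 <= q1 / q2 by rewrite divr_ge0.
  have qq : `|q1 / q2| < 1 by rewrite (ger0_norm q12ge) ltr_pdivrMr// mul1r.
  have s0 : 0 < eta * c / (`|I| + 1) by rewrite !(mulr_gt0, invr_gt0)//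
    ltr_wpDl.
  have /cvgrPdist_lt /(_ _ s0) [N _ NP] := cvg_expr qq.
  exists N => k Nk; have := NP k Nk; rewrite /= sub0r normrN normrX.
  rewrite (ger0_norm q12ge) ltr_pdivlMr ?ltr_wpDl// => h.
  apply: (@le_trans _ _ (q1 ^+ k * (`|I| + 1))).
    by rewrite ler_wpM2l ?exprn_ge0// (le_trans (ler_norm I))// lerDl.
  have qk : 0 < q2 ^+ k by rewrite exprn_gt0.
  rewrite mulrA -ler_pdivrMr// mulrAC -expr_div_n; exact: ltW.
exists k0 => k h h0 e kk hb h0C e0 hh0.
have ik := peaked_integrable k.
have ih := exp_bounded_integrable (peaked_exp_bounded k hb) wl.
have C0 := exp_bounded_ge0 hb.
rewrite -RintegralZl// -RintegralB//; last exact: integrable_mull.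
apply: (@le_trans _ _ (\int[mu]_(t in `]0, +oo[)
    (e * (expR (- (l * t)) * rho t ^+ k) + q1 ^+ k * G t))).
  have ib : mu.-integrable `]0, +oo[ (EFin \o (fun t : R =>
      e * (expR (- (l * t)) * rho t ^+ k) + q1 ^+ k * G t)).
    have i1 := integrable_mull e mpos ik.
    have i2 := integrable_mull (q1 ^+ k) mpos iG.
    by apply: eq_integrable (integrableD mpos i1 i2).
  apply: (normr_Rintegral_le _ _ _ ib) => //.
    apply: measurable_funB.
      by apply/measurable_EFinP; exact: measurable_int ih.
    by apply/measurable_EFinP;
      exact: measurable_int (integrable_mull h0 mpos ik).
  move=> t /pos_if t0.
  set v := expR _; set r := rho t ^+ k.
  have v0 : 0 <= v by exact: expR_ge0.
  have r0 : 0 <= r by exact: rhoX_ge0.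
  have G0 : 0 <= G t by rewrite addr_ge0// mulr_ge0// expR_ge0.
  have -> : v * (r * h t) - h0 * (v * r) = (v * r) * (h t - h0) by ring.
  rewrite normrM ger0_norm ?mulr_ge0//.
  have [td|dt] := ltrP `|t - p| d.
    rewrite mulrC ler_wpDr ?mulr_ge0 ?exprn_ge0 ?(ltW q10)//.
    by rewrite ler_wpM2r ?mulr_ge0// hh0.
  rewrite ler_wpDl ?mulr_ge0//.
  have rq1 : r <= q1 ^+ k.
    apply: lerXn2r; rewrite ?nnegrE ?rho_ge0 ?(ltW q10)//.
    by rewrite (le_trans (rq t t0 dt))// /q1 le_max lexx.
  have -> : G t = v * (C * expR (w * t) + C).
    rewrite /G /v (_ : - ((l - w) * t) = - (l * t) + w * t) ?expRD; ring.
  rewrite [v * r]mulrC -mulrA; apply: ler_pM => //; first by rewrite mulr_ge0.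
  apply: ler_wpM2l => //; rewrite (le_trans (ler_normB _ _))// lerD//.
  exact: hb.2.
rewrite RintegralD//; [|exact: integrable_mull|exact: integrable_mull].
rewrite !RintegralZl// mulrDl lerD2l (le_trans (k0P k kk))//.
by apply: ler_wpM2l => //; exact: ltW.
Qed.

End peaked.
End concentration.

Section peaks.
Context (R : realType).

Let mexpN (D : set R) : measurable_fun D (fun t : R => expR (- t)).
Proof. by apply: measurable_funTS; apply: measurableT_comp. Qed.

Lemma expRN_le1 (t : R) : 0 <= t -> expR (- t) <= 1.
Proof. by move=> t0; rewrite -expR0 ler_expR oppr_le0. Qed.

Lemma expRN_ge (t : R) : 1 - t <= expR (- t).
Proof. exact: expR_ge1Dx. Qed.

(** The weight behind [l R(l) f --> f]: its [k]-th power turns the Laplace transform at [l] into the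
    one at [l + k]. *)
Lemma peaked_expRN : peaked (fun t : R => expR (- t)) 0.
Proof.
split.
- exact: mexpN.
- by move=> t t0; rewrite expR_ge0 expRN_le1// ltW.
- move=> e e0; exists (expR (- e)); first by rewrite expR_lt1 oppr_lt0.
  by move=> t t0; rewrite subr0 gtr0_norm// ler_expR lerN2.
- move=> q q1; exists 0, (1 - q); split; [by []|by rewrite subr_gt0|].
  by move=> t /andP[_ tq]; apply: le_trans (expRN_ge t); lra.
Qed.

Lemma expRN_sub (s t : R) : 0 <= s -> s <= t ->
  0 <= expR (- s) - expR (- t) <= t - s.
Proof.
move=> s0 st; have -> : expR (- s) - expR (- t) = expR (- s) * (1 - expR (- (t
  - s))).
  by rewrite mulrBr mulr1 -expRD; congr (_ - expR _); lra.
have ts0 : 0 <= t - s by rewrite subr_ge0.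
have := expRN_le1 ts0; have := expRN_ge (t - s); have := expRN_le1 s0.
have := expR_ge0 (- s); set a := expR (- s); set b := expR (- (t - s)).
move=> a0 a1 bg bl; apply/andP; split; first by rewrite mulr_ge0 ?subr_ge0.
by rewrite -[leRHS]mul1r; apply: ler_pM; rewrite ?subr_ge0//; lra.
Qed.

Lemma peaked_expRN_sqr (p : R) : 0 < p ->
  peaked (fun t : R => 1 - (expR (- t) - expR (- p)) ^+ 2) p.
Proof.
move=> p0; have p0' := ltW p0; split.
- apply: measurable_funB => //; apply: measurable_funX.
  by apply: measurable_funB => //; exact: mexpN.
- move=> t t0; rewrite lerBlDr lerDl sqr_ge0 andbT subr_ge0.
  have := expRN_le1 (ltW t0); have := expRN_le1 p0'.
  have := expR_ge0 (- t); have := expR_ge0 (- p).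
  set a := expR (- p); set b := expR (- t) => ? ? ? ?; nra.
- move=> e e0.
  (* The gaps of [expR (- t)] at [p + e] and at [p - e]. When [e >= p] no positive time lies at
     distance [e] to the left of [p], and [1] is a filler. *)
  pose k1 := expR (- p) - expR (- (p + e)).
  pose k2 := if e < p then expR (- (p - e)) - expR (- p) else 1.
  have k10 : 0 < k1 by rewrite /k1 subr_gt0 ltr_expR; lra.
  have k20 : 0 < k2 by rewrite /k2; case: ifP => // _;
    rewrite subr_gt0 ltr_expR; lra.
  have m0 : 0 < Num.min k1 k2 by rewrite lt_min k10.
  exists (1 - Num.min k1 k2 ^+ 2); first by rewrite ltrBlDr ltrDl exprn_gt0.
  move=> t t0 et; rewrite lerD2l lerN2.
  suff : Num.min k1 k2 <= `|expR (- t) - expR (- p)|.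
    move=> h; rewrite -[leRHS]real_normK ?num_real//.
    by apply: lerXn2r; rewrite ?nnegrE ?(ltW m0).
  have [pt|tp] := lerP p t.
    have {}et : e <= t - p by move: et; rewrite ger0_norm ?subr_ge0.
    rewrite ge_min; apply/orP; left; rewrite distrC (le_trans _ (ler_norm _))//.
    by rewrite lerD2l lerN2 ler_expR; lra.
  have {}et : e <= p - t by move: et; rewrite distrC gtr0_norm ?subr_gt0.
  rewrite ge_min; apply/orP; right; rewrite (le_trans _ (ler_norm _))//.
  by rewrite /k2 ifT ?lerD2r ?ler_expR; lra.
(* To the right of [p] the difference of exponentials is at most [b], and [b ^+ 2 <= b <= 1 - q]
   because [b <= 1]. *)
- move=> q q1; pose b := Num.min 1 (1 - q).
  have [b0 b1 bq] : [/\ 0 < b, b <= 1 & b <= 1 - q].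
    by rewrite /b; case: (lerP 1 (1 - q)) => ?; split; lra.
  exists p, (p + b); split => //; first by rewrite ltrDl.
  move=> t /andP[pt tb]; have /andP[h1 h2] := expRN_sub p0' (ltW pt).
  move: h1 h2; set x := expR (- p); set y := expR (- t) => h1 h2; nra.
Qed.

End peaks.

Section approximation.
Context (R : realType) (E : ptopologicalType).
Local Notation mu := (@lebesgue_measure R).
Implicit Types (f g u : E -> R) (l t a r : R).

Section resolvent_approximation.
Variables (T : R -> @op R E) (M w : R) (hT : kernel_semigroup T M w).

Let pos_if (t : R) : `]0, +oo[%classic t <-> (0 < t).
Proof. by rewrite /= in_itv/= andbT. Qed.

(** The closeness of [T t f] to [f] is asked at the single point [x], while [k0] is independent of
    [x]: the same statement gives pointwise convergence on [Cb] and uniform convergence on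
    [Cinf]. *)
Lemma laplace_approx (l d eta r : R) : w < l -> 0 < l -> 0 < d -> 0 < eta ->
  exists k0, forall k f x e, (k0 <= k)%N -> Bb f -> (forall y, `|f y| <= r) ->
    0 <= e -> (forall t, 0 < t < d -> `|T t f x - f x| <= e) ->
    `|(l + k%:R) * laplace T (l + k%:R) f x - f x| <= e + eta.
Proof.
move=> wl l0 d0 eta0.
(* The constant must bound [f x] as well as the orbit, and [M] is not assumed to be at least [1]. *)
have [k0 k0P] := peaked_concentration (@peaked_expRN R) l0 (Num.max M 1 * r) wl
  d0 eta0.
exists k0 => k f x e kk Bf fr e0 Tf.
have r0 : 0 <= r by exact: le_trans (fr x).
have [hm hb] := semigroup_exp_bounded hT x Bf fr.
have hb' : exp_bounded (fun t => T t f x) (Num.max M 1 * r) w.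
  split=> // t t0; rewrite (le_trans (hb t t0))//.
  by rewrite ler_wpM2r ?expR_ge0// ler_wpM2r// le_max lexx.
have fx : `|f x| <= Num.max M 1 * r.
  by rewrite (le_trans (fr x))// ler_peMl// le_max lexx orbT.
have Tf' t : 0 < t -> `|t - 0| < d -> `|T t f x - f x| <= e.
  by move=> t0; rewrite subr0 gtr0_norm// => td; apply: Tf; rewrite t0.
have := k0P k _ (f x) e kk hb' fx e0 Tf'.
have lk0 : 0 < l + k%:R by rewrite ltr_wpDr.
have expk (t : R) : expR (- (l * t)) * expR (- t) ^+ k = expR (- ((l + k%:R) *
  t)).
  by rewrite -expRM_natl -expRD; congr expR; lra.
have -> : \int[mu]_(t in `]0, +oo[) (expR (- (l * t)) * expR (- t) ^+ k) =
    (l + k%:R)^-1.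
  under eq_Rintegral do rewrite expk.
  by rewrite Rintegral_expRN// mulr0 oppr0 expR0 div1r.
have -> : \int[mu]_(t in `]0,
  +oo[) (expR (- (l * t)) * (expR (- t) ^+ k * T t f x)) =
    laplace T (l + k%:R) f x.
  by rewrite laplaceE; under eq_Rintegral do rewrite mulrA expk.
move=> h; rewrite -(ler_pM2l (x := (l + k%:R)^-1)) ?invr_gt0//.
rewrite [leRHS]mulrC -[X in X * _ <= _]gtr0_norm ?invr_gt0// -normrM.
by rewrite mulrBr mulKf ?gt_eqF// [_^-1 * f x]mulrC.
Qed.

Lemma laplace_approx_bound (l r : R) k f x : w < l -> 0 < l -> Bb f ->
  (forall y, `|f y| <= r) ->
  `|(l + k%:R) * laplace T (l + k%:R) f x| <= (l / (l - w) + 1) * (M * r).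
Proof.
move=> wl l0 Bf fr; have k0 : 0 <= k%:R :> R by [].
have wlk : w < l + k%:R by lra.
have lk0 : 0 < l + k%:R by lra.
have := laplace_norm hT x wlk Bf fr.
rewrite ler_pdivlMr ?subr_gt0// => h.
rewrite normrM gtr0_norm//.
have lw : 0 < l - w by lra.
(* With denominator [D = l - w + k], [l <= l / (l - w) * D] and [k <= D], whatever the sign of
   [w]. *)
have c : l + k%:R <= (l / (l - w) + 1) * (l + k%:R - w).
  rewrite -[l + k%:R - w]/(l + k%:R - w) (_ : l + k%:R - w = (l - w) + k%:R);
    last lra.
  rewrite mulrDl mul1r mulrDr divfK ?gt_eqF//.
  have : 0 <= l / (l - w) * k%:R by rewrite mulr_ge0// divr_ge0// ltW.
  lra.
apply: (le_trans (ler_wpM2r (normr_ge0 _) c)).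
rewrite -mulrA; apply: ler_wpM2l.
  by rewrite addr_ge0// divr_ge0// ltW.
by rewrite mulrC.
Qed.

Hypothesis cT : Cb_semigroup T.

Lemma laplace_approx_cvg (l : R) f : w < l -> 0 < l -> Cb f -> forall x,
  (l + k%:R) * laplace T (l + k%:R) f x @[k --> \oo] --> f x.
Proof.
move=> wl l0 Cf x; have Bf := Cb_Bb Cf; have [_ [r fr]] := Bf.
apply/cvgrPdist_le => e e0.
have e2 : 0 < e / 2 by rewrite divr_gt0.
have /cvgrPdist_le /(_ _ e2) := (cT.2 f Cf).2 x.
move=> [d /= d0 dP].
have [k0 k0P] := laplace_approx r wl l0 d0 e2.
exists k0 => // k /= kk; rewrite distrC [leRHS](splitr e).
apply: k0P => //; first exact: ltW.
move=> t /andP[t0 td]; rewrite distrC; apply: dP => //=.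
by rewrite sub0r normrN gtr0_norm.
Qed.

Lemma semigroup_cvg0 f : Cb f -> exists s : nat -> R, exists C,
  [/\ forall n, 0 < s n, forall n x, `|T (s n) f x| <= C &
      forall x, T (s n) f x @[n --> \oo] --> f x].
Proof.
move=> Cf; have [[d d0 [C dC]] cf] := cT.2 f Cf.
(* The offset keeps every [s n] strictly below [d]. *)
pose s (n : nat) : R := d / n.+2%:R.
have s0 n : 0 < s n by rewrite divr_gt0.
exists s, C; split => //.
- move=> n x; apply: dC; rewrite s0/= /s ltr_pdivrMr// ltr_pMr// ltr1n//.
- move=> x; apply/cvgrPdist_lt => e e0.
  have /cvgrPdist_lt /(_ _ e0) [b /= b0 bP] := cf x.
  exists (Num.truncn (d / b)).+1 => // n /= dn; apply: bP => //=.
  rewrite sub0r normrN gtr0_norm// /s ltr_pdivrMr// mulrC -ltr_pdivrMr//.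
  by apply: (lt_le_trans (truncnS_gt _)); rewrite ler_nat (leq_trans dn)// ltnW.
Qed.

End resolvent_approximation.
End approximation.

(** * The perturbed semigroup *)

Section perturbation.
Context (R : realType) (E : ptopologicalType).
Local Notation mu := (@lebesgue_measure R).
Implicit Types (f g u : E -> R) (l t a r : R).
Hypotheses (polE : @polish_space R E).
Variables (T : R -> @op R E) (M w : R) (DB : set (E -> R)) (B : @op R E)
  (BT : R -> @op R E).
Hypotheses (hT : kernel_semigroup T M w) (cT : Cb_semigroup T).
Hypotheses (linB : linear_on DB B) (domB :
  rel_domain (full_generator T) `<=` DB).
Hypotheses (kBT : forall t, 0 < t -> kernel_op (BT t))
  (BTE : forall t, 0 < t -> forall u, rel_domain (full_generator T) u ->
    BT t u = B (T t u)).
Hypothesis kBR : forall l, w < l -> kernel_op (fun f => B (laplace T l f)).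
Hypothesis mBT : forall f, Bb f -> jointly_measurable (fun t => BT t f).

Let pos_if (t : R) : `]0, +oo[%classic t <-> (0 < t).
Proof. by rewrite /= in_itv/= andbT. Qed.

Lemma laplace_domain l f : w < l -> 0 < l -> Bb f ->
  rel_domain (full_generator T) (laplace T l f).
Proof.
move=> wl l0 Bf; exists (fun x => l * laplace T l f x - f x).
exact (full_generator_laplace hT wl l0 Bf).
Qed.

Lemma domain_laplace l u : w < l -> 0 < l ->
  rel_domain (full_generator T) u -> exists2 f, Bb f & u = laplace T l f.
Proof.
move=> wl l0 [g Aug]; have [Bu Bg _] := (full_generatorP hT u g).1 Aug.
exists (fun x => l * u x - g x);
  last by rewrite (laplace_full_generator hT wl l0 Aug).
rewrite (_ : (fun x => _) = fun x => -1 * g x + l * u x).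
  by apply: Bb_lin => //; exact: Bb_scale.
by apply/funext => x; rewrite mulN1r addrC.
Qed.

Lemma domain_semigroup t u : 0 < t -> rel_domain (full_generator T) u ->
  rel_domain (full_generator T) (T t u).
Proof.
move=> t0; pose l := Num.max 0 w + 1.
have [l0 wl] : 0 < l /\ w < l by rewrite /l; case: (lerP 0 w) => ?; split; lra.
move=> /(domain_laplace wl l0)[f Bf ->].
rewrite (semigroup_laplace_comm hT)//.
by apply: laplace_domain => //; exact: (semigroup_Bb hT).
Qed.

(** A continuous [f] is the bp-limit of [(l + k) R(l + k) f], which lies in the domain; the monotone
    class principle does the rest. *)
Lemma domain_bp_dense (P : (E -> R) -> Prop) :
  (forall u, Bb u -> rel_domain (full_generator T) u -> P u) ->
  (forall a f g, Bb f -> Bb g -> P f -> P g -> P (fun x => a * f x + g x)) ->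
  (forall (f_ : nat -> E -> R) f (C : R), (forall n, Bb (f_ n)) ->
    (forall n, P (f_ n)) -> (forall n x, `|f_ n x| <= C) ->
    (forall x, f_ n x @[n --> \oo] --> f x) -> P f) ->
  forall f, Bb f -> P f.
Proof.
move=> Pdom Plin Pbp; apply: (Bb_ind polE) => // f Cf.
have Bf := Cb_Bb Cf; have [_ [r fr]] := Bf.
pose l := Num.max 0 w + 1.
have [l0 wl] : 0 < l /\ w < l by rewrite /l; case: (lerP 0 w) => ?; split; lra.
have lk k : 0 < l + k%:R /\ w < l + k%:R.
  by have : 0 <= k%:R :> R by []; split; lra.
have BR k : Bb (laplace T (l + k%:R) f) by apply: (laplace_Bb hT) => //;
  case: (lk k).
apply: (Pbp (fun k x => (l + k%:R) * laplace T (l + k%:R) f x) _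
  ((l / (l - w) + 1) * (M * r))).
- by move=> k; exact: Bb_scale.
- move=> k; have [lk0 wlk] := lk k.
  rewrite -(laplace_scale hT)//; apply: Pdom.
    by apply: (laplace_Bb hT) => //; exact: Bb_scale.
  by apply: laplace_domain => //; exact: Bb_scale.
- by move=> k x; apply: (laplace_approx_bound hT).
- by move=> x; exact: (laplace_approx_cvg hT).
Qed.

(** For [u] in the domain both sides equal [B (T t (T s u))], since [T s] preserves the domain; both
    sides are linear and bp-continuous in [f]. *)
Lemma BT_comp t s f : 0 < t -> 0 < s -> Bb f -> BT (t + s) f = BT t (T s f).
Proof.
move=> t0 s0; have ts0 : 0 < t + s by exact: addr_gt0.
move: f; apply: (domain_bp_dense (P := fun f => BT (t + s) f = BT t (T s f))).
- move=> u Bu Du; rewrite BTE// BTE//; last exact: domain_semigroup.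
  by rewrite (semigroup_comp hT).
- move=> a f g Bf Bg Pf Pg.
  rewrite (kernel_op_lin _ (kBT ts0))//
    (kernel_op_lin _ (semigroup_kernel hT s0))//.
  rewrite (kernel_op_lin _ (kBT t0));
    [|exact: (semigroup_Bb hT)|exact: (semigroup_Bb hT)].
  by rewrite Pf Pg.
- move=> f_ f C Bf Pf fC ff; apply/funext => x.
  have c1 := kernel_op_cvg (kBT ts0) Bf fC ff x.
  have c2 : BT t (T s (f_ n)) x @[n --> \oo] --> BT t (T s f) x.
    apply: (kernel_op_cvg (kBT t0) (f_ := fun n =>
      T s (f_ n)) (C := M * C * expR (w * s))).
    + by move=> n; exact: (semigroup_Bb hT).
    + by move=> n y; exact: (semigroup_norm hT).
    + by move=> y; exact: (kernel_op_cvg (semigroup_kernel hT s0)).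
  move: c1; under eq_fun do rewrite Pf.
  by move=> c1; exact: (cvg_unique _ c1 c2).
Qed.

Variable (phi : R -> R) (d : R).
Hypotheses (d0 : 0 < d) (iphi : mu.-integrable `]0, d[ (fun t => (phi t)%:E))
  (BTphi : forall t, 0 < t -> opnorm_le (BT t) (phi t)).

Let phi_ge0 t : 0 < t -> 0 <= phi t.
Proof.
move=> t0; have := BTphi t0 (r := 1) (Bb_cst E 1).
by rewrite normr1 mulr1 => /(_ (fun=> lexx _) point); apply: le_trans.
Qed.

(** From time [d] on, the bound comes from factoring [BT t] as [BT (d / 2)] after
    [T (t - d / 2)]. *)
Definition BT_majorant (t : R) : R :=
  (if 0 < t < d then phi t else 0) + phi (d / 2) * M * expR (w * (t - d / 2)).

Lemma BT_majorantP t : 0 < t -> opnorm_le (BT t) (BT_majorant t).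
Proof.
move=> t0 f r Bf fr x; have r0 : 0 <= r by exact: le_trans (fr x).
have M0 := semigroup_const_ge0 hT.
have d20 : 0 < d / 2 by rewrite divr_gt0.
have p2 := phi_ge0 d20; have pt := phi_ge0 t0.
have e0 : 0 <= phi (d / 2) * M * expR (w * (t - d / 2)).
  by rewrite !mulr_ge0 ?expR_ge0.
rewrite /BT_majorant t0 /=; case: ltrP => td.
  rewrite (le_trans (BTphi t0 Bf fr x))// ler_wpM2r// lerDl//.
have td0 : 0 < t - d / 2 by lra.
rewrite add0r (_ : t = d / 2 + (t - d / 2)); last lra.
rewrite BT_comp//; apply: le_trans.
  apply: (BTphi d20 (r := M * r * expR (w * (t - d / 2)))).
    exact: (semigroup_Bb hT).
  by move=> y; exact: (semigroup_norm hT).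
rewrite (_ : d / 2 + (t - d / 2) - d / 2 = t - d / 2); lra.
Qed.

Lemma BT_majorant_integrable l : w < l -> 0 < l ->
  mu.-integrable `]0, +oo[ (EFin \o (fun t =>
    expR (- (l * t)) * BT_majorant t)).
Proof.
move=> wl l0; have mpos : measurable (`]0,
  +oo[%classic : set (measurableTypeR R)) by [].
have oo_if t : `]0, d[%classic t <-> 0 < t < d by rewrite /= in_itv.
have i1 : mu.-integrable setT (EFin \o (fun t =>
  if 0 < t < d then phi t else 0)).
  exact/(integrable_if mu oo_if).
have i1' : mu.-integrable `]0, +oo[ (EFin \o (fun t =>
  if 0 < t < d then phi t else 0)).
  exact: integrableS i1.
have lw : 0 < l - w by lra.
have i2 := integrable_mull (phi (d / 2) * M * expR (- (w * (d / 2)))) mpos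
  (integrable_expRN 0 lw).
have i3 : mu.-integrable `]0, +oo[ (EFin \o (fun t =>
  (if 0 < t < d then phi t else 0) +
    phi (d / 2) * M * expR (- (w * (d / 2))) * expR (- ((l - w) * t)))).
  by apply: eq_integrable (integrableD mpos i1' i2).
apply: (integrable_le mpos _ _ i3).
  apply: measurable_funM; first exact: measurable_expRN.
  apply: measurable_funD; first by apply/measurable_EFinP;
    exact: measurable_int i1'.
  apply: measurable_funM => //; apply: measurableT_comp => //.
  by apply: measurable_funM => //; exact: measurable_funB.
have M0 := semigroup_const_ge0 hT.
have d20 : 0 < d / 2 by rewrite divr_gt0.
move=> t /pos_if t0; have p2 := phi_ge0 d20; have pt := phi_ge0 t0.
have i0 : 0 <= if 0 < t < d then phi t else 0 by case: ifP.
have e0 : 0 <= phi (d / 2) * M * expR (w * (t - d / 2)).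
  by rewrite !mulr_ge0 ?expR_ge0.
rewrite ger0_norm; last by rewrite mulr_ge0 ?expR_ge0// addr_ge0.
rewrite /BT_majorant mulrDr lerD//.
  by rewrite ler_piMl// -expR0 ler_expR oppr_le0 mulr_ge0 ?ltW.
rewrite mulrCA -[leRHS]mulrA -!expRD le_eqVlt; apply/orP; left; apply/eqP.
by congr (_ * expR _); lra.
Qed.

Lemma BT_measurable_time f x : Bb f ->
  measurable_fun (`]0, +oo[%classic : set R) (fun t => BT t f x).
Proof. by move=> Bf; exact: jointly_measurable_time (mBT Bf). Qed.

Let mpos : measurable (`]0, +oo[%classic : set (measurableTypeR R)).
Proof. by []. Qed.

Lemma BT_laplace_le l f r t x : Bb f -> (forall y, `|f y| <= r) -> 0 < t ->
  `|expR (- (l * t)) * BT t f x| <= r * (expR (- (l * t)) * BT_majorant t).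
Proof.
move=> Bf fr t0; rewrite normrM ger0_norm ?expR_ge0// mulrCA [r * _]mulrC.
by rewrite ler_wpM2l ?expR_ge0//; exact: BT_majorantP.
Qed.

Lemma BT_laplace_integrable l f x : w < l -> 0 < l -> Bb f ->
  mu.-integrable `]0, +oo[ (EFin \o (fun t => expR (- (l * t)) * BT t f x)).
Proof.
move=> wl l0 Bf; have [_ [r fr]] := Bf.
apply: (integrable_le mpos _ _ (integrable_mull r mpos (BT_majorant_integrable
  wl l0))).
  by apply: measurable_funM;
    [exact: measurable_expRN|exact: BT_measurable_time].
by move=> t /pos_if t0; exact: BT_laplace_le.
Qed.

Lemma BT_laplace_cvg l (f_ : nat -> E -> R) f C x : w < l -> 0 < l ->
  (forall n, Bb (f_ n)) -> (forall n y, `|f_ n y| <= C) ->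
  (forall y, f_ n y @[n --> \oo] --> f y) ->
  \int[mu]_(t in `]0, +oo[) (expR (- (l * t)) * BT t (f_ n) x) @[n --> \oo] -->
  \int[mu]_(t in `]0, +oo[) (expR (- (l * t)) * BT t f x).
Proof.
move=> wl l0 Bf fC ff.
apply: (Rintegral_dominated_cvg mpos _ _
  (integrable_mull C mpos (BT_majorant_integrable wl l0))).
- by move=> n; apply: measurable_funM;
  [exact: measurable_expRN|exact: BT_measurable_time].
- move=> t /pos_if t0; apply: cvgMl_tmp.
  exact: (kernel_op_cvg (kBT t0) Bf fC ff).
- by move=> n t /pos_if t0; exact: BT_laplace_le.
Qed.

Arguments BT_laplace_cvg {l f_ f C} x _ _ _ _ _.

(* For [f] continuous, [BT s R(l) f = B R(l) T(s) f] is computed in two ways as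
   [s] tends to [0]. *)
Lemma B_laplaceE l f x : w < l -> 0 < l -> Bb f ->
  B (laplace T l f) x = \int[mu]_(t in `]0, +oo[) (expR (- (l * t)) * BT t f x).
Proof.
move=> wl l0 Bf; move: f Bf x.
have kB := kBR wl.
apply: (Bb_ind polE (P := fun f => forall x, B (laplace T l f) x =
  \int[mu]_(t in `]0, +oo[) (expR (- (l * t)) * BT t f x))).
- move=> f Cf x; have Bf := Cb_Bb Cf.
  have [s [C [s0 sC sf]]] := semigroup_cvg0 cT Cf.
  have BTs n : Bb (T (s n) f) by exact: (semigroup_Bb hT).
  have c1 := kernel_op_cvg kB BTs sC sf x.
  have c2 := BT_laplace_cvg x wl l0 BTs sC sf.
  move: c1; rewrite (_ : (fun n => _) = fun n =>
    \int[mu]_(t in `]0, +oo[) (expR (- (l * t)) * BT t (T (s n) f) x));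
      last first.
    apply/funext => n; rewrite -(semigroup_laplace_comm hT)//.
    rewrite -BTE//; last exact: laplace_domain.
    have [_ ->] := kernel_op_laplace hT x wl Bf (kBT (s0 n)).
    apply: eq_Rintegral => t; rewrite inE => /pos_if t0.
    by rewrite -!BT_comp// addrC.
  by move=> c1; exact: (cvg_unique _ c1 c2).
- move=> a f g Bf Bg Pf Pg x.
  have /funeqP -> := kernel_op_lin a kB Bf Bg.
  rewrite Pf Pg -RintegralZl ?BT_laplace_integrable// -RintegralD//.
  + apply: eq_Rintegral => t; rewrite inE => /pos_if t0.
    by rewrite (kernel_op_lin _ (kBT t0))//; lra.
  + by apply: integrable_mull => //; exact: BT_laplace_integrable.
  + exact: BT_laplace_integrable.
- move=> f_ f C Bf Pf fC ff x.
  have c1 := kernel_op_cvg kB Bf fC ff x.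
  have c2 := BT_laplace_cvg x wl l0 Bf fC ff.
  move: c1; under eq_fun do rewrite Pf.
  by move=> c1; exact: (cvg_unique _ c1 c2).
Qed.

(** The norm of [B R(l)] is at most the Laplace transform of [BT_majorant]. This decreases in [l]
    and tends to [0] along [l1 + n] by dominated convergence. *)
Lemma B_laplace_small eps : 0 < eps -> exists L, [/\ 0 < L, w < L &
  forall l f r, L <= l -> Bb f -> (forall y, `|f y| <= r) ->
  forall x, `|B (laplace T l f) x| <= r * eps].
Proof.
move=> eps0; pose l1 := Num.max 0 w + 1.
have [l10 wl1] : 0 < l1 /\ w < l1 by rewrite /l1; case: (lerP 0 w) => ?;
  split; lra.
have i1 := BT_majorant_integrable wl1 l10.
have m1 := measurable_int _ i1.
have Phi0 t : 0 < t -> 0 <= BT_majorant t.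
  move=> t0; have := BT_majorantP t0 (r := 1) (Bb_cst E 1).
  by rewrite normr1 mulr1 => /(_ (fun=> lexx _) point); apply: le_trans.
pose F (n : nat) (t : R) := expR (- t) ^+ n * (expR (- (l1 * t)) * BT_majorant
  t).
have c : \int[mu]_(t in `]0, +oo[) F n t @[n --> \oo] -->
    \int[mu]_(t in `]0, +oo[) (0 : R).
  apply: (Rintegral_dominated_cvg mpos _ _ i1).
  - move=> n; apply: measurable_funM; last exact/measurable_EFinP.
    by apply: measurable_funX; apply: measurable_funTS; apply: measurableT_comp.
  - move=> t /pos_if t0; rewrite -(mul0r (expR (- (l1 * t)) * BT_majorant t)).
    apply: cvgMr_tmp; apply: cvg_expr.
    by rewrite ger0_norm ?expR_ge0// expR_lt1 oppr_lt0.
  - move=> n t /pos_if t0; rewrite ger0_norm; last first.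
      by rewrite !mulr_ge0 ?exprn_ge0 ?expR_ge0 ?Phi0.
    rewrite ler_piMl ?mulr_ge0 ?expR_ge0 ?Phi0// exprn_ile1 ?expR_ge0//.
    by apply: expRN_le1; exact: ltW.
rewrite Rintegral0// in c.
have /cvgrPdist_lt /(_ _ eps0) [N _ /(_ N (leqnn N))] := c.
rewrite sub0r normrN => small.
exists (l1 + N%:R); split.
- by rewrite ltr_wpDr.
- by rewrite ltr_wpDr.
move=> l f r Ll Bf fr x.
have r0 : 0 <= r by exact: le_trans (fr x).
have N0 : 0 <= N%:R :> R by [].
have wl : w < l by lra.
have l0 : 0 < l by lra.
rewrite B_laplaceE//.
have iF : mu.-integrable `]0, +oo[ (EFin \o F N).
  apply: (integrable_le mpos _ _ i1).
    apply: measurable_funM; last exact/measurable_EFinP.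
    by apply: measurable_funX; apply: measurable_funTS; apply: measurableT_comp.
  move=> t /pos_if t0; rewrite ger0_norm; last first.
    by rewrite !mulr_ge0 ?exprn_ge0 ?expR_ge0 ?Phi0.
  rewrite ler_piMl ?mulr_ge0 ?expR_ge0 ?Phi0// exprn_ile1 ?expR_ge0//.
  by apply: expRN_le1; exact: ltW.
apply: (@le_trans _ _ (\int[mu]_(t in `]0, +oo[) (r * F N t))).
  apply: (normr_Rintegral_le mpos _ _ (integrable_mull r mpos iF)).
    by apply: measurable_funM;
      [exact: measurable_expRN|exact: BT_measurable_time].
  move=> t /pos_if t0; rewrite (le_trans (BT_laplace_le l x Bf fr t0))//.
  rewrite ler_wpM2l// /F mulrA ler_wpM2r ?Phi0//.
  rewrite -expRM_natl -expRD ler_expR.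
  by have := ler_wpM2r (ltW t0) Ll; lra.
rewrite RintegralZl// ler_wpM2l// (le_trans _ (ltW small))//.
exact: ler_norm.
Qed.

Hypothesis lcE : @locally_compact_space E.
Hypothesis BTinf : forall t, 0 < t -> forall f, Binf f -> Binf (BT t f).

(** Along a sequence leaving every compact set the integrand tends to [0] at each time, under the
    majorant. *)
Lemma B_laplace_Binf l f : w < l -> 0 < l -> Binf f -> Binf (B (laplace T l f)).
Proof.
move=> wl l0 [Bf vf]; split.
  by have [_ [_ BB]] := linB; apply/BB/domB; exact: laplace_domain.
apply/(vanishes_at_infinity_seqP lcE polE) => x_ x_oo; have [_ [r fr]] := Bf.
have c : \int[mu]_(t in `]0,
  +oo[) (expR (- (l * t)) * BT t f (x_ n)) @[n --> \oo]
    --> \int[mu]_(t in `]0, +oo[) (0 : R).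
  apply: (Rintegral_dominated_cvg mpos _ _
    (integrable_mull r mpos (BT_majorant_integrable wl l0))).
  - by move=> n; apply: measurable_funM;
    [exact: measurable_expRN|exact: BT_measurable_time].
  - move=> t /pos_if t0; rewrite -(mulr0 (expR (- (l * t)))); apply: cvgMl_tmp.
    have [_ /(vanishes_at_infinity_seqP lcE polE)] := BTinf t0 (conj Bf vf).
    exact.
  - by move=> n t /pos_if t0; exact: BT_laplace_le.
rewrite Rintegral0// in c.
by under eq_fun do rewrite B_laplaceE//.
Qed.

End perturbation.

(** * Vanishing at infinity for [T] and its resolvent *)

Section vanishing.
Context (R : realType) (E : ptopologicalType).
Local Notation mu := (@lebesgue_measure R).
Implicit Types (f g u : E -> R) (l t a r e : R).

Lemma vanishes_uniform_lim f :
  (forall e, 0 < e -> exists2 g, vanishes_at_infinity g &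
    forall x, `|f x - g x| <= e) -> vanishes_at_infinity f.
Proof.
move=> fg e e0; have e2 : 0 < e / 2 by rewrite divr_gt0.
have [g vg fge] := fg _ e2; have [K [cK gK]] := vg _ e2.
exists K; split => // x Kx; rewrite -(subrK (g x) (f x)) (splitr e).
by rewrite (le_trans (ler_normD _ _))// lerD// gK.
Qed.

Lemma vanishes_lin a f g : vanishes_at_infinity f -> vanishes_at_infinity g ->
  vanishes_at_infinity (fun x => a * f x + g x).
Proof.
move=> vf vg e e0; have a0 : 0 < `|a| + 1 by rewrite ltr_wpDl.
have e1 : 0 < e / 2 / (`|a| + 1) by rewrite !divr_gt0.
have e2 : 0 < e / 2 by rewrite divr_gt0.
have [K [cK fK]] := vf _ e1; have [L [cL gL]] := vg _ e2.
exists (K `|` L); split; first exact: compactU.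
move=> x /not_orP[Kx Lx]; rewrite (splitr e) (le_trans (ler_normD _ _))//.
rewrite lerD ?gL// normrM.
have := fK x Kx; rewrite ler_pdivlMr// => h.
by rewrite (le_trans _ h)// mulrC ler_wpM2l// lerDl.
Qed.

Lemma vanishes_cst0 : vanishes_at_infinity (fun _ : E => 0 : R).
Proof.
by move=> e e0; exists set0; split; [exact: compact0|move=> x _;
  rewrite normr0 ltW].
Qed.

Lemma vanishes_scale a f : vanishes_at_infinity f ->
  vanishes_at_infinity (fun x => a * f x).
Proof.
move=> vf; have := vanishes_lin a vf vanishes_cst0.
by under [X in vanishes_at_infinity X]eq_fun do rewrite addr0.
Qed.

Lemma Cinf_Cb f : Cinf f -> Cb f.
Proof.
move=> [cf vf]; split => //; have [K [cK fK]] := vf 1 ltr01.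
have /compact_bounded[C [_ CP]] : compact (f @` K).
  by apply: continuous_compact => //; exact: continuous_subspaceT.
exists (Num.max 1 (C + 1)) => x; rewrite le_max.
have [Kx|Kx] := pselect (K x); last by rewrite fK.
by rewrite (CP (C + 1)) ?orbT ?ltrDl//; exists x.
Qed.

Lemma Cinf_Binf f : Cinf f -> Binf f.
Proof. by move=> Cf; split; [exact: Cb_Bb (Cinf_Cb Cf)|case: Cf]. Qed.

Hypotheses (lcE : @locally_compact_space E) (polE : @polish_space R E).

Section positive.
Variables (T : R -> @op R E) (M w : R) (hT : kernel_semigroup T M w).

Let pos_if t : `]0, +oo[%classic t <-> (0 < t).
Proof. by rewrite /= in_itv/= andbT. Qed.

(** [f] need not be continuous, so it is dominated by [C * h] plus a small constant, with [h] in
    [Cinf]. Positivity carries the domination over to [T t f]. *)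
Lemma positive_Cinf_vanishes t f : positive_semigroup T -> Cinf_semigroup T ->
  0 < t -> Binf f -> vanishes_at_infinity (T t f).
Proof.
move=> pT iT t0 [Bf vf] e e0; have [_ [C fC]] := Bf.
have C0 : 0 <= C by exact: le_trans (fC point).
have kT := semigroup_kernel hT t0.
(* [m] exceeds the norm of [T t], so the constant [e / 2 / m] contributes at most [e / 2]; the [1]
   makes it positive. *)
pose m := M * expR (w * t) + 1.
have m0 : 0 < m by rewrite ltr_wpDl// mulr_ge0 ?expR_ge0//
  (semigroup_const_ge0 hT).
have d0 : 0 < e / 2 / m by rewrite !divr_gt0.
have [K [cK fK]] := vf _ d0.
have [h [Ch h01 hK]] := compact_Cinf_majorant lcE polE cK.
have Bh := (Cinf_Binf Ch).1.
pose g x := C * h x + e / 2 / m.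
have Bg : Bb g by apply: Bb_lin => //; exact: Bb_cst.
have fg x : `|f x| <= g x.
  have /andP[h0 h1] := h01 x; have [Kx|Kx] := pselect (K x).
    by rewrite /g hK// mulr1 (le_trans (fC x))// lerDl ltW.
  by rewrite (le_trans (fK x Kx))// lerDr mulr_ge0.
have Tfg x : `|T t f x| <= T t g x.
  (* Used for [a = 1] and [a = -1], which give the two sides of the absolute value. *)
  have pos a : `|a| <= 1 -> 0 <= T t (fun x => a * f x + g x) x.
    move=> a1; apply: pT => //; first exact: Bb_lin.
    move=> y; have := fg y; have : `|a * f y| <= `|f y|.
      by rewrite normrM ler_piMl.
    by rewrite ler_norml => /andP[]; lra.
  have n1 : `|-1 : R| <= 1 by rewrite normrN normr1.
  have p1 : `|1 : R| <= 1 by rewrite normr1.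
  have lin a : T t (fun x => a * f x + g x) x = a * T t f x + T t g x.
    by rewrite (kernel_op_lin a kT Bf Bg).
  have := pos _ n1; have := pos _ p1; rewrite !lin => q1 q2.
  by rewrite ler_norml; apply/andP; split; lra.
have [_ vh] := iT.1 t t0 h Ch.
have e2C : 0 < e / 2 / (C + 1) by rewrite !divr_gt0// ltr_wpDl.
have [L [cL hL]] := vh _ e2C.
exists L; split => // x Lx; rewrite (le_trans (Tfg x))//.
rewrite (kernel_op_lin C kT Bh (Bb_cst E (e / 2 / m))) [leRHS]splitr lerD//.
  have := hL x Lx; rewrite ler_pdivlMr ?ltr_wpDl// => h'.
  apply: le_trans h'; rewrite mulrC.
  apply: (le_trans (ler_wpM2r C0 (ler_norm _))).
  by rewrite ler_wpM2l// lerDl.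
have := semigroup_norm hT x t0 (Bb_cst E (e / 2 / m)) (r := e / 2 / m).
rewrite gtr0_norm// => /(_ (fun=> lexx _)) h'.
apply: (le_trans (ler_norm _)); apply: (le_trans h').
have -> : M * (e / 2 / m) * expR (w * t) = (e / 2 / m) * (M * expR (w * t)) by
  lra.
rewrite -[leRHS](divfK (lt0r_neq0 m0)) ler_wpM2l ?(ltW d0)//.
by rewrite /m lerDl.
Qed.

Lemma laplace_vanishes l f : w < l -> Bb f ->
  (forall t, 0 < t -> vanishes_at_infinity (T t f)) ->
  vanishes_at_infinity (laplace T l f).
Proof.
move=> wl Bf Tf; apply/(vanishes_at_infinity_seqP lcE polE) => x_ x_oo.
have mpos : measurable (`]0, +oo[%classic : set (measurableTypeR R)) by [].
have [_ [r fr]] := Bf.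
have lw : 0 < l - w by rewrite subr_gt0.
have ib := integrable_mull (M * r) mpos (integrable_expRN 0 lw).
have c : \int[mu]_(t in `]0,
  +oo[) (expR (- (l * t)) * T t f (x_ n)) @[n --> \oo]
    --> \int[mu]_(t in `]0, +oo[) (0 : R).
  apply: (Rintegral_dominated_cvg mpos _ _ ib).
  - move=> n; apply/measurable_EFinP.
    exact: measurable_int (laplace_integrable hT (x_ n) wl Bf).
  - move=> t /pos_if t0; rewrite -(mulr0 (expR (- (l * t)))); apply: cvgMl_tmp.
    by have /(vanishes_at_infinity_seqP lcE polE) := Tf t t0; exact.
  - move=> n t /pos_if t0; rewrite normrM ger0_norm ?expR_ge0//.
    apply: (le_trans (ler_wpM2l (expR_ge0 _) (semigroup_norm hT (x_ n) t0 Bf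
      fr))).
    rewrite mulrCA -expRD le_eqVlt; apply/orP; left; apply/eqP.
    by congr (_ * expR _); lra.
by rewrite Rintegral0// in c.
Qed.

End positive.

End vanishing.

(** * From the resolvent back to the semigroup *)

Section Cinf_criterion.
Context (R : realType) (E : ptopologicalType).
Local Notation mu := (@lebesgue_measure R).
Implicit Types (f g u : E -> R) (l t a r e : R).
Variables (S : R -> @op R E) (M w : R) (hS : kernel_semigroup S M w).

Let pos_if t : `]0, +oo[%classic t <-> (0 < t).
Proof. by rewrite /= in_itv/= andbT. Qed.

Let M0 : 0 <= M := semigroup_const_ge0 hS.

Lemma expR_le_abs t b : 0 < t -> t <= b -> expR (w * t) <= expR (`|w| * b).
Proof.
move=> t0 tb; rewrite ler_expR (le_trans (y := `|w| * t))//.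
  by rewrite ler_wpM2r ?ler_norm// ltW.
by rewrite ler_wpM2l.
Qed.

Lemma expR_le_abs1 t : 0 < t -> t <= 1 -> expR (w * t) <= expR `|w|.
Proof. by move=> t0 t1; have := expR_le_abs t0 t1; rewrite mulr1. Qed.

(** The increment of the orbit is the integral of [S r g x] over the interval from [s] to [t]. The
    constant does not depend on [x], which provides the modulus of continuity needed for uniform
    concentration. *)
Lemma full_generator_lipschitz u g G b : full_generator S (u, g) ->
  (forall x, `|g x| <= G) -> forall s t x, 0 < s -> s <= t -> t <= b ->
  `|S t u x - S s u x| <= M * G * expR (`|w| * b) * (t - s).
Proof.
move=> /(full_generatorP hS)[Bu Bg ug] gG s t x s0 st tb.
have t0 : 0 < t by exact: lt_le_trans st.
have ig := semigroup_integrable_oc hS t x Bg.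
rewrite !ug// opprD addrACA subrr add0r.
rewrite (Rintegral_itvB ig) ?bnd_simp ?(ltW s0)//.
have mst : measurable (`]s, t]%classic : set (measurableTypeR R)) by [].
have mst0 : measurable (`]0, t]%classic : set (measurableTypeR R)) by [].
have sub : (`]s, t]%classic : set R) `<=` `]0, t]%classic.
  by move=> r /=; rewrite !in_itv/= => /andP[/(lt_trans s0) -> ->].
have igs := integrableS mst0 mst sub ig.
pose c := M * G * expR (`|w| * b).
apply: (@le_trans _ _ (\int[mu]_(r in `]s, t]) c)).
  apply: normr_Rintegral_le => //.
  - by apply/measurable_EFinP; exact: measurable_int igs.
  - move=> r /=; rewrite in_itv/= => /andP[sr rt].
    have r0 : 0 < r by exact: lt_trans sr.
    apply: (le_trans (semigroup_norm hS x r0 Bg gG)).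
    apply: ler_wpM2l; first by rewrite mulr_ge0// (le_trans _ (gG x)).
    by apply: expR_le_abs => //; exact: le_trans tb.
  - exact: (integrableS mst0 mst sub (exp_bounded_integrable_oc t
    (exp_bounded_cst c))).
rewrite Rintegral_cst//.
suff -> : fine (mu `]s, t]) = t - s by [].
rewrite lebesgue_measure_itv/= lte_fin; case: ltgtP st => // -> _.
by rewrite subrr.
Qed.

Lemma full_generator_lipschitz0 u g G : full_generator S (u, g) ->
  (forall x, `|g x| <= G) -> forall t x, 0 < t -> t <= 1 ->
  `|S t u x - u x| <= M * G * expR `|w| * t.
Proof.
move=> /(full_generatorP hS)[Bu Bg ug] gG t x t0 t1.
have ig := semigroup_integrable_oc hS t x Bg.
rewrite ug// addrC addKr.
pose c := M * G * expR `|w|.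
apply: (@le_trans _ _ (\int[mu]_(r in `]0, t]) c)).
  apply: normr_Rintegral_le => //.
  - by apply/measurable_EFinP; exact: measurable_int ig.
  - move=> r /=; rewrite in_itv/= => /andP[r0 rt].
    apply: (le_trans (semigroup_norm hS x r0 Bg gG)).
    apply: ler_wpM2l; first by rewrite mulr_ge0// (le_trans _ (gG x)).
    by apply: expR_le_abs1 => //; exact: le_trans t1.
  - exact: exp_bounded_integrable_oc (exp_bounded_cst c).
rewrite Rintegral_cst//.
suff -> : fine (mu `]0, t]) = t by [].
by rewrite lebesgue_measure_itv/= lte_fin t0/= oppr0 addr0.
Qed.

Variable L : R.
Hypotheses (L0 : 0 < L) (wL : w < L).
Hypothesis resolvent_vanishes : forall l f, L <= l -> Binf f ->
  vanishes_at_infinity (laplace S l f).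

(** With [z = expR (- t)] the weight is [(1 - y ^+ 2) + 2 * y * z - z ^+ 2], and a factor [z] raises
    [l] by one. The induction on [k] therefore has to keep [l] general. *)
Lemma weighted_laplace_vanishes y k l f : L <= l -> Binf f ->
  vanishes_at_infinity (fun x => \int[mu]_(t in `]0, +oo[)
    (expR (- (l * t)) * ((1 - (expR (- t) - y) ^+ 2) ^+ k * S t f x))).
Proof.
move=> Ll Binff; have [Bf _] := Binff; have [_ [r fr]] := Bf.
have mpos : measurable (`]0, +oo[%classic : set (measurableTypeR R)) by [].
pose rho t := 1 - (expR (- t) - y) ^+ 2.
have mrho : measurable_fun (`]0, +oo[%classic : set R) rho.
  apply: measurable_funB => //; apply: measurable_funX;
    apply: measurable_funB => //.
  by apply: measurable_funTS; apply: measurableT_comp.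
have rhob t : 0 < t -> `|rho t| <= 1 + (1 + `|y|) ^+ 2.
  move=> t0; rewrite (le_trans (ler_normB _ _))// normr1 lerD2l normrX.
  apply: lerXn2r; rewrite ?nnegrE ?addr_ge0//.
  rewrite (le_trans (ler_normB _ _))// lerD2r ger0_norm ?expR_ge0//.
  by apply: expRN_le1; exact: ltW.
have eb n x : exp_bounded (fun t => rho t ^+ n * S t f x)
    ((1 + (1 + `|y|) ^+ 2) ^+ n * (M * r)) w.
  have [ms bs] := semigroup_exp_bounded hS x Bf fr.
  split; first by apply: measurable_funM => //; exact: measurable_funX.
  move=> t t0; rewrite normrM -mulrA; apply: ler_pM => //; last exact: bs.
  by rewrite normrX; apply: lerXn2r; rewrite ?nnegrE ?addr_ge0 ?sqr_ge0 ?rhob.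
have int n x l' : L <= l' -> mu.-integrable `]0, +oo[
    (EFin \o (fun t => expR (- (l' * t)) * (rho t ^+ n * S t f x))).
  by move=> Ll'; apply: (exp_bounded_integrable (eb n x));
    exact: lt_le_trans Ll'.
elim: k l Ll => [|k ih] l Ll.
  rewrite (_ : (fun x => _) = laplace S l f); first exact: resolvent_vanishes.
  by apply/funext => x; rewrite laplaceE; apply: eq_Rintegral => t _;
    rewrite expr0 mul1r.
have l1 : L <= l + 1 by lra.
have l2 : L <= l + 1 + 1 by lra.
have v := vanishes_lin (1 - y ^+ 2) (ih l Ll)
  (vanishes_lin (2 * y) (ih _ l1) (vanishes_scale (-1) (ih _ l2))).
move: v; set v := (X in vanishes_at_infinity X -> _) => vv.
rewrite (_ : (fun x => _) = v)//; apply/esym/funext => x; rewrite /v {v vv}.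
rewrite -!RintegralZl ?int// -RintegralD//; last 2 first.
  by apply: integrable_mull => //; exact: int.
  by apply: integrable_mull => //; exact: int.
rewrite -RintegralD//; last 2 first.
- by apply: integrable_mull => //; exact: int.
- apply: eq_integrable (integrableD mpos
    (integrable_mull (2 * y) mpos (int k x _ l1))
    (integrable_mull (-1) mpos (int k x _ l2))) => //.
apply: eq_Rintegral => t _.
have -> : expR (- ((l + 1 + 1) * t)) = expR (- (l * t)) * expR (- t) ^+ 2.
  by rewrite -expRM_natl -expRD; congr expR; lra.
have -> : expR (- ((l + 1) * t)) = expR (- (l * t)) * expR (- t).
  by rewrite -expRD; congr expR; lra.
rewrite [_ ^+ k.+1]exprS -/(rho t); set p := rho t ^+ k; rewrite /rho.
set a := expR (- t); set b := expR (- (l * t)); set c := S t f x; ring.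
Qed.

(** The normalised weighted transforms vanish at infinity and approach [S t u] uniformly, because
    the orbits of [u] are equi-Lipschitz. *)
Lemma full_generator_vanishes u g t : full_generator S (u, g) -> Binf u ->
  0 < t -> vanishes_at_infinity (S t u).
Proof.
move=> Sug Binfu t0; have [Bu _] := Binfu.
have [_ [r ur]] := Bu.
have [_ [_ [G gG]] _] := (full_generatorP hS u g).1 Sug.
apply: vanishes_uniform_lim => e e0.
have e2 : 0 < e / 2 by rewrite divr_gt0.
have G0 : 0 <= G by exact: le_trans (gG point).
have r0 : 0 <= r by exact: le_trans (ur point).
pose c := M * G * expR (`|w| * (t + 1)).
have c0 : 0 <= c by rewrite !mulr_ge0 ?expR_ge0.
(* The bound by [1] keeps the times within [t + 1], where the Lipschitz constant [c] is valid; the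
   last one makes the oscillation at most [e / 2]. *)
pose d := Num.min (Num.min 1 t) (e / 2 / (c + 1)).
have c1 : 0 < c + 1 by rewrite ltr_wpDl.
have d0 : 0 < d by rewrite !lt_min ltr01 t0 divr_gt0.
have [d1 dt dc] : [/\ d <= 1, d <= t & d <= e / 2 / (c + 1)].
  by split; rewrite !ge_min lexx ?orbT.
(* One constant for both requirements: [M * r] for the orbit and [M * r * expR (w * t)] for its
   value at [t]. *)
pose C := M * r * (1 + expR (w * t)).
have MrC : M * r <= C by rewrite /C ler_peMr ?mulr_ge0// lerDl expR_ge0.
have [k0 k0P] := peaked_concentration (peaked_expRN_sqr t0) L0 C wL d0 e2.
pose rho (s : R) := 1 - (expR (- s) - expR (- t)) ^+ 2.
pose J := \int[mu]_(s in `]0, +oo[) (expR (- (L * s)) * rho s ^+ k0).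
have J0 : 0 < J.
  have h2 : 0 < 1 / 2 :> R by lra.
  have h1 : 1 / 2 < 1 :> R by lra.
  have [b b0 bJ] := peaked_lower_bound (peaked_expRN_sqr t0) L0 h2 h1.
  by apply: (lt_le_trans _ (bJ k0)); rewrite mulr_gt0// exprn_gt0.
exists (fun x => J^-1 * \int[mu]_(s in `]0, +oo[)
    (expR (- (L * s)) * (rho s ^+ k0 * S s u x))).
  by apply: vanishes_scale; exact: weighted_laplace_vanishes.
move=> x.
have [ms bs] := semigroup_exp_bounded hS x Bu ur.
have eb : exp_bounded (fun s => S s u x) C w.
  by split=> // s s0; rewrite (le_trans (bs s s0))// ler_wpM2r// expR_ge0.
have bt : `|S t u x| <= C.
  apply: (le_trans (bs t t0)); rewrite /C ler_wpM2l ?mulr_ge0//.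
  by rewrite lerDr.
have near s : 0 < s -> `|s - t| < d -> `|S s u x - S t u x| <= e / 2.
  move=> s0 sd.
  have cd : c * `|s - t| <= e / 2.
    have : `|s - t| * (c + 1) <= e / 2.
      by rewrite -ler_pdivlMr// (le_trans (ltW sd)).
    by have := normr_ge0 (s - t); lra.
  have sd' := lt_le_trans sd d1.
  apply: le_trans cd; have [st|ts] := lerP s t.
    rewrite (distrC (S s u x)).
    by apply: (full_generator_lipschitz Sug gG) => //; rewrite lerDl.
  apply: (full_generator_lipschitz Sug gG) => //; first exact: ltW.
  by have := ler_norm (s - t); lra.
have := k0P k0 _ (S t u x) (e / 2) (leqnn _) eb bt (ltW e2) near.
rewrite -splitr -/(rho _) -/J => h.
rewrite -(ler_pM2l J0) -{1}(gtr0_norm J0) -normrM mulrBr mulrA divff ?gt_eqF//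
  mul1r.
by rewrite distrC (mulrC J e) (mulrC J (S t u x)).
Qed.

Hypothesis cS : Cb_semigroup S.
Hypothesis resolvent_approx : forall f, Cinf f -> forall e, 0 < e ->
  exists2 l, L <= l & forall x, `|l * laplace S l f x - f x| <= e.

(** The functions [u = l RS(l) f] lie in the generator domain and in [Binf], and approximate [f]
    uniformly. Both properties are known for [u] and pass to [f] since [S t] is bounded for times in
    bounded sets. *)
Lemma Cinf_semigroup_of_resolvent : Cinf_semigroup S.
Proof.
have approx f e : Cinf f -> 0 < e -> exists u g, [/\ full_generator S (u, g),
    Binf u & forall x, `|u x - f x| <= e].
  move=> Cf e0; have [l Ll lf] := resolvent_approx Cf e0.
  have l0 : 0 < l by exact: lt_le_trans Ll.
  have wl : w < l by exact: lt_le_trans Ll.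
  have [Bf vf] := Cinf_Binf Cf.
  have Blf := Bb_scale l Bf.
  exists (laplace S l (fun x => l * f x)).
  eexists; split.
  - exact (full_generator_laplace hS wl l0 Blf).
  - split; first exact: (laplace_Bb hS).
    by apply: resolvent_vanishes => //; split => //; exact: vanishes_scale.
  - by move=> x; rewrite (laplace_scale hS).
have Sdiff t f u e x : 0 < t -> Bb f -> Bb u -> (forall y, `|u y - f y| <= e) ->
    `|S t u x - S t f x| <= M * e * expR (w * t).
  move=> t0 Bf Bu uf.
  have Bd : Bb (fun y => -1 * f y + u y) by exact: Bb_lin.
  have -> : S t u x - S t f x = S t (fun y => -1 * f y + u y) x.
    by rewrite (kernel_op_lin _ (semigroup_kernel hS t0))//; lra.
  by apply: (semigroup_norm hS) => // y; rewrite mulN1r addrC.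
split=> [t t0 f Cf|f Cf e e0].
  have [Bf _] := Cinf_Binf Cf.
  split; first by have [] := cS.1 t t0 f (Cinf_Cb Cf).
  apply: vanishes_uniform_lim => e e0.
  pose m := M * expR (w * t) + 1.
  have m0 : 0 < m by rewrite ltr_wpDl// mulr_ge0// expR_ge0.
  have em : 0 < e / m by rewrite divr_gt0.
  have [u [g [Sug Binfu uf]]] := approx f _ Cf em.
  exists (S t u); first exact: full_generator_vanishes Sug Binfu t0.
  move=> x; rewrite distrC; have [Bu _] := Binfu.
  rewrite (le_trans (Sdiff _ _ _ _ x t0 Bf Bu uf))//.
  rewrite mulrAC mulrC -[leRHS](divfK (lt0r_neq0 m0)) ler_wpM2l ?(ltW em)//.
  by rewrite /m lerDl.
have [Bf _] := Cinf_Binf Cf.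
pose m := M * expR `|w| + 1.
have m0 : 0 < m by rewrite ltr_wpDl// mulr_ge0// expR_ge0.
have e3 : 0 < e / 3 by rewrite divr_gt0.
(* The first bound controls [u - f] itself, the second its image under [S t] for [t <= 1]. *)
have em : 0 < Num.min (e / 3) (e / 3 / m) by rewrite lt_min e3 divr_gt0.
have [u [g [Sug Binfu uf]]] := approx f _ Cf em.
have [Bu [_ [G gG]] _] := (full_generatorP hS u g).1 Sug.
have G0 : 0 <= G by exact: le_trans (gG point).
pose c := M * G * expR `|w|.
have c0 : 0 <= c by rewrite !mulr_ge0 ?expR_ge0.
have c1 : 0 < c + 1 by rewrite ltr_wpDl.
exists (Num.min 1 (e / 3 / (c + 1))); first by rewrite lt_min ltr01 divr_gt0.
move=> t /andP[t0]; rewrite lt_min => /andP[t1 tc] x.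
have a1 : `|S t u x - S t f x| <= e / 3.
  rewrite (le_trans (Sdiff _ _ _ _ x t0 Bf Bu uf))//.
  have q1 : expR (w * t) <= expR `|w|.
    by apply: expR_le_abs1 => //; exact: ltW.
  have q2 : M * expR (w * t) <= m.
    by rewrite (le_trans (ler_wpM2l M0 q1))// lerDl.
  rewrite mulrAC mulrC -[leRHS](divfK (lt0r_neq0 m0)).
  apply: ler_pM => //; first exact: ltW.
    by rewrite mulr_ge0// expR_ge0.
  by rewrite ge_min lexx orbT.
have a2 : `|S t u x - u x| <= e / 3.
  rewrite (le_trans (full_generator_lipschitz0 Sug gG x t0 (ltW t1)))//.
  have : t * (c + 1) <= e / 3 by rewrite -ler_pdivlMr// ltW.
  by rewrite /c; lra.
have a3 : `|u x - f x| <= e / 3.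
  by rewrite (le_trans (uf x))// ge_min lexx.
have -> : S t f x - f x = - (S t u x - S t f x) + (S t u x - u x) + (u x - f x)
  by lra.
rewrite (le_trans (ler_normD _ _))//;
  have := ler_normD (- (S t u x - S t f x)) (S t u x - u x).
by rewrite normrN; lra.
Qed.

End Cinf_criterion.

(** * The resolvent of the perturbed semigroup *)

Section perturbed_resolvent.
Context (R : realType) (E : ptopologicalType).
Implicit Types (f g u : E -> R) (l t a r e : R).
Variables (T S : R -> @op R E) (M w M' w' : R) (B : @op R E).
Hypotheses (hT : kernel_semigroup T M w) (hS : kernel_semigroup S M' w')
  (genS : full_generator S = rel_add (full_generator T) B).

(** The generator of [S] contains the pair of [R(l) f] and [l R(l) f - f + B R(l) f], so [RS(l)]
    maps [f - B R(l) f] to [R(l) f]. *)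
Lemma laplace_perturbed l f : w < l -> w' < l -> 0 < l -> Bb f ->
  Bb (B (laplace T l f)) ->
  laplace S l f =
  (fun x => laplace T l f x + laplace S l (B (laplace T l f)) x).
Proof.
move=> wl wl' l0 Bf BBf.
have Suf : full_generator S (laplace T l f,
    (fun x => l * laplace T l f x - f x) \+ B (laplace T l f)).
  by rewrite genS; apply: rel_add_in;
    exact (full_generator_laplace hT wl l0 Bf).
have := laplace_full_generator hS wl' l0 Suf.
rewrite (_ : (fun x => _) = fun x => -1 * B (laplace T l f) x + f x);
  last first.
  by apply/funext => x /=; lra.
rewrite (laplace_lin hS)// => /funeqP e; apply/funext => x.
by rewrite -e; lra.
Qed.

Hypotheses (lcE : @locally_compact_space E) (polE : @polish_space R E).

(* Neumann series: [RS(l) = R(l) + RS(l) B R(l)], and [B R(l)] halves the norm. *)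
Lemma perturbed_resolvent_vanishes l : w < l -> w' < l -> 0 < l ->
  (forall f, Binf f -> vanishes_at_infinity (laplace T l f)) ->
  (forall f, Binf f -> Binf (B (laplace T l f))) ->
  (forall f r, Bb f -> (forall y, `|f y| <= r) ->
    forall x, `|B (laplace T l f) x| <= r * (1 / 2)) ->
  forall f, Binf f -> vanishes_at_infinity (laplace S l f).
Proof.
move=> wl wl' l0 vT Binf_B Bhalf f Binff.
have lw : 0 < l - w' by rewrite subr_gt0.
pose c := M' / (l - w').
have c0 : 0 <= c by rewrite divr_ge0 ?(semigroup_const_ge0 hS)// ltW.
(* [f] and [r] stay quantified because the induction hypothesis is applied to [B R(l) f] with half
   the bound. *)
have approx n : forall f r, Binf f -> (forall y, `|f y| <= r) ->
    exists2 g, vanishes_at_infinity g &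
      forall x, `|laplace S l f x - g x| <= c * (1 / 2) ^+ n * r.
  elim: n => [|n ih] {Binff}{}f r Binff fr; have [Bf _] := Binff.
    exists (fun=> 0); first exact: vanishes_cst0.
    move=> x; rewrite subr0 expr0 mulr1.
    by have := laplace_norm hS x wl' Bf fr; rewrite /c mulrAC.
  have Binfu := Binf_B f Binff; have [Bu _] := Binfu.
  have [g vg gS] := ih _ _ Binfu (Bhalf f r Bf fr).
  exists (fun x => 1 * laplace T l f x + g x);
    first exact: vanishes_lin (vT f Binff) vg.
  move=> x; rewrite (laplace_perturbed wl wl' l0 Bf Bu) mul1r opprD addrACA
    subrr add0r.
  by rewrite (le_trans (gS x))// exprSr; lra.
have [[_ [r fr]] _] := Binff.
have r0 : 0 <= r by exact: le_trans (fr point).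
apply: vanishes_uniform_lim => e e0.
have h : `|1 / 2 : R| < 1 by rewrite ger0_norm; lra.
have cr : 0 < c * r + 1 by rewrite ltr_wpDl// mulr_ge0.
have s0 : 0 < e / (c * r + 1) by rewrite divr_gt0.
have /cvgrPdist_lt /(_ _ s0) [N _ /(_ N (leqnn N))] := cvg_expr h.
rewrite sub0r normrN ger0_norm; last by rewrite exprn_ge0//; lra.
rewrite ltr_pdivlMr// => small.
have [g vg gS] := approx N f r Binff fr.
exists g => // x; apply: (le_trans (gS x)); apply: le_trans (ltW small).
have : 0 <= (1 / 2 : R) ^+ N by rewrite exprn_ge0//; lra.
by set p := (1 / 2) ^+ N => p0; lra.
Qed.

(** [l RS(l) f - f] is [l R(l) f - f], small since [T] is strongly continuous on [Cinf], plus
    [l RS(l)] applied to the small function [B R(l) f]; the norm of [l RS(l)] stays bounded. *)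
Lemma perturbed_resolvent_approx L : w < L -> w' < L -> 0 < L ->
  (forall l f, L <= l -> Bb f -> Bb (B (laplace T l f))) ->
  (forall eps, 0 < eps -> exists L', forall l f r, L' <= l -> L <= l -> Bb f ->
    (forall y, `|f y| <= r) -> forall x, `|B (laplace T l f) x| <= r * eps) ->
  Cinf_semigroup T ->
  forall f, Cinf f -> forall e, 0 < e ->
  exists2 l, L <= l & forall x, `|l * laplace S l f x - f x| <= e.
Proof.
move=> wL wL' L0 BBf Bsmall iT f Cf e e0; have [Bf _] := Cinf_Binf Cf.
have [_ [r fr]] := Bf.
have r0 : 0 <= r by exact: le_trans (fr point).
have M'0 := semigroup_const_ge0 hS.
(* Only [2 * (M' * r) <= m] is required: it brings the correction term below [e / 2]. *)
pose m := 3 * (M' * r) + 1.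
have m0 : 0 < m by rewrite /m ltr_wpDl// !mulr_ge0.
have e2m : 0 < e / 2 / m by rewrite !divr_gt0.
have e4 : 0 < e / 4 by rewrite divr_gt0.
have [L' BL'] := Bsmall _ e2m.
(* From [2 * |w'|] on one has [l <= 2 * (l - w')], so that [l RS(l)] has norm at most [2 * M']. *)
pose l1 := Num.max L (Num.max L' (2 * `|w'|)).
have [lL lL' lw'] : [/\ L <= l1, L' <= l1 & 2 * `|w'| <= l1].
  by split; rewrite !le_max lexx ?orbT.
have l10 : 0 < l1 by exact: lt_le_trans lL.
have wl1 : w < l1 by exact: lt_le_trans lL.
have [d d0 dT] := iT.2 f Cf _ e4.
have [k kP] := laplace_approx hT r wl1 l10 d0 e4.
have k0 : 0 <= k%:R :> R by [].
pose l := l1 + k%:R; have ll1 : l1 <= l by rewrite /l lerDl.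
have Ll : L <= l by exact: le_trans ll1.
have wl : w < l by exact: lt_le_trans Ll.
have wl' : w' < l by exact: lt_le_trans Ll.
have l0 : 0 < l by exact: lt_le_trans Ll.
exists l => // x.
rewrite (laplace_perturbed wl wl' l0 Bf (BBf l f Ll Bf)) mulrDr addrAC.
have a1 : `|l * laplace T l f x - f x| <= e / 4 + e / 4.
  by apply: kP => //; [exact: ltW|move=> t t0d; exact: dT].
have a2 : `|l * laplace S l (B (laplace T l f)) x| <= e / 2.
  have lw0 : 0 < l - w' by rewrite subr_gt0.
  have Bb1 := BBf l f Ll Bf.
  have b1 := BL' l f r (le_trans lL' ll1) Ll Bf fr.
  have := laplace_norm hS x wl' Bb1 b1; rewrite ler_pdivlMr// => b2.
  have l2 : l <= 2 * (l - w').
    have := ler_norm w'; have := lw'; have := ll1; lra.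
  rewrite normrM (gtr0_norm l0).
  apply: (le_trans (ler_wpM2r (normr_ge0 _) l2)).
  rewrite -mulrA [(l - w') * _]mulrC.
  have b3 : 2 * (M' * (r * (e / 2 / m))) <= e / 2.
    rewrite -[leRHS](divfK (lt0r_neq0 m0)).
    have q : 0 <= M' * r by rewrite mulr_ge0.
    have -> : 2 * (M' * (r * (e / 2 / m))) = (e / 2 / m) * (2 * (M' * r)) by
      lra.
    by apply: ler_wpM2l; [exact: ltW|rewrite /m; lra].
  by apply: le_trans b3; rewrite ler_wpM2l.
by rewrite (le_trans (ler_normD _ _))//; lra.
Qed.

End perturbed_resolvent.

Theorem theorem4p4 (R : realType) (E : ptopologicalType)
  (T : R -> @op R E) (M w : R) (DB : set (E -> R)) (Bhat : @op R E)
  (BT : R -> @op R E) :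
  @locally_compact_space E -> @polish_space R E ->
  (* T: C_b-semigroup of kernel operators of type (M, w), strong Feller *)
  kernel_semigroup T M w -> Cb_semigroup T ->
  (forall t, 0 < t -> strong_feller (T t)) ->
  (* T is moreover a positive C_infty-semigroup *)
  positive_semigroup T -> Cinf_semigroup T ->
  (* Bhat: single-valued linear operator, D(A) subset D(B) *)
  linear_on DB Bhat ->
  rel_domain (full_generator T) `<=` DB ->
  (* (i) BT t is a kernel operator extending Bhat T(t) from D(A) *)
  (forall t, 0 < t -> kernel_op (BT t) /\
     forall u, rel_domain (full_generator T) u -> BT t u = Bhat (T t u)) ->
  (* (ii) *)
  (forall l, w < l -> kernel_op (fun f => Bhat (laplace T l f))) ->
  (* (iii) *)
  (forall f, Bb f -> jointly_measurable (fun t => BT t f)) ->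
  (* (iv) *)
  (exists phi : R -> R, (exists2 d : R, 0 < d &
       (@lebesgue_measure R).-integrable `]0, d[ (fun t => (phi t)%:E)) /\
     forall t, 0 < t -> opnorm_le (BT t) (phi t)) ->
  (* S: the C_b-semigroup of kernel operators with full generator A + B *)
  forall S : R -> @op R E,
  (exists M' w' : R, kernel_semigroup S M' w') -> Cb_semigroup S ->
  full_generator S = rel_add (full_generator T) Bhat ->
  (* (a) *)
  (forall D, bp_core (full_generator T) D ->
     bp_core (rel_add (full_generator T) Bhat) (rel_add D Bhat)) /\
  (* (b) *)
  ((forall t, 0 < t -> forall f, Binf f -> Binf (BT t f)) -> Cinf_semigroup S).
Proof.
move=> lcE polE hT cT _ pT iT linB domB hBT kBR mBT [phi [[d d0 iphi] BTphi]].
move=> S [M' [w' hS]] cS genS.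
have kBT t (t0 : 0 < t) := (hBT t t0).1.
have BTE t (t0 : 0 < t) := (hBT t t0).2.
have BBf l f : w < l -> 0 < l -> Bb f -> Bb (Bhat (laplace T l f)).
  by move=> wl l0 Bf; apply/linB.2.2/domB; exact: (laplace_domain hT).
pose l := Num.max 0 w + 1.
have [l0 wl] : 0 < l /\ w < l by rewrite /l; case: (lerP 0 w) => ?; split; lra.
split=> [D coreD|BTinf].
  apply: (bp_core_perturbation hT wl l0 (kBR l wl)) => //.
  by rewrite -genS; exact: (full_generator_bp_closed hS).
have small := B_laplace_small polE hT cT kBT BTE kBR mBT d0 iphi BTphi.
(* Norm [1 / 2] makes the Neumann iteration contract. *)
have [|L1 [L10 wL1 half]] := small (1 / 2); first by lra.
(* The growth bound [w'] of [S] is unrelated to [w], and [L] has to exceed both. *)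
pose L := Num.max L1 (Num.max 0 w' + 1).
have [L1L wL' L0] : [/\ L1 <= L, w' < L & 0 < L].
  have L'L : Num.max 0 w' + 1 <= L by rewrite /L le_max lexx orbT.
  have m0 : 0 <= Num.max 0 w' by rewrite le_max lexx.
  have mw : w' <= Num.max 0 w' by rewrite le_max lexx orbT.
  by split; [rewrite /L le_max lexx|lra|lra].
have wL : w < L by exact: lt_le_trans L1L.
have vS k f : L <= k -> Binf f -> vanishes_at_infinity (laplace S k f).
  move=> Lk; have wk : w < k by exact: lt_le_trans Lk.
  have wk' : w' < k by exact: lt_le_trans Lk.
  have k0 : 0 < k by exact: lt_le_trans Lk.
  apply: (perturbed_resolvent_vanishes hT hS genS wk wk' k0).
  - move=> h Binfh; apply: (laplace_vanishes lcE polE hT wk Binfh.1) => t t0.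
    exact: (positive_Cinf_vanishes lcE polE hT).
  - by move=> h; exact: (B_laplace_Binf polE hT cT linB domB kBT BTE kBR mBT d0
    iphi BTphi).
  - by move=> h r; apply: half; exact: le_trans Lk.
apply: (Cinf_semigroup_of_resolvent hS L0 wL' vS cS).
apply: (perturbed_resolvent_approx hT hS genS wL wL' L0) => //.
  move=> k f Lk Bf; apply: BBf => //; first exact: lt_le_trans Lk.
  exact: lt_le_trans Lk.
move=> eps /small[L2 [_ _ h]]; exists L2 => k f r L2k _; exact: h.
Qed.
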